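(* Let $n>5$ be an integer and let $K=\{123,231\}\{321,213\}$. If $n$ is odd, there are exactly $3n-1$ equivalence classes of $S_n$ under $K$-equivalence; if $n$ is even, there are exactly $3n$.
   Context: Permutations in $S_n$ are written as words $\pi_1\pi_2\cdots\pi_n$ in one-line notation. The order permutation of a word $u$ of $c$ distinct positive integers is the unique $\sigma\in S_c$ with $\sigma_i<\sigma_j$ iff $u_i<u_j$. A replacement partition $K$ of $S_c$ is a set partition of $S_c$; it is denoted by listing its parts with the one-element parts (and outer brackets) omitted, so here $K$ is the set partition of $S_3$ whose only parts of size greater than one are $\{123,231\}$ and $\{321,213\}$. The $K$-equivalence on $S_n$ is the equivalence relation generated by: $\phi\equiv\psi$ whenever $\phi=aub$ and $\psi=avb$ (concatenations) for some possibly empty words $a,b$ and words $u,v$ of length $c$ (so $u,v$ occupy the same $c$ consecutive positions) such that the order permutations of $u$ and $v$ lie in the same part of $K$. All equivalence classes are counted, including one-element classes. *)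

(* Defs.v *)
From mathcomp Require Import all_boot all_fingroup.

Set Implicit Arguments.
Unset Strict Implicit.
Unset Printing Implicit Defensive.

(* One-line notation pi_1 pi_2 ... pi_n with letters 1, ..., n; a permutation of
   'I_n acts on 0, ..., n-1, whence the shift by one. *)
Definition oneline n (s : 'S_n) : seq nat := [seq (s i).+1 | i <- enum 'I_n].

Lemma size_oneline n (s : 'S_n) : size (oneline s) = n.
Proof. by rewrite size_map size_enum_ord. Qed.

Lemma nth_oneline n (s : 'S_n) (i : 'I_n) : nth 0 (oneline s) i = (s i).+1.
Proof.
by rewrite (nth_map i) ?size_enum_ord ?ltn_ord // nth_ord_enum.
Qed.

Lemma oneline_inj n : injective (@oneline n).
Proof.
move=> s t st; apply/permP => i; apply/val_inj/succn_inj.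
by rewrite -!nth_oneline st.
Qed.

Definition is_order_perm c (u : seq nat) (sigma : 'S_c) : bool :=
  (size u == c) &&
  [forall i : 'I_c, forall j : 'I_c, (sigma i < sigma j) == (nth 0 u i < nth 0 u j)].

Definition order_perms_together c (K : {set {set 'S_c}}) (u v : seq nat) : bool :=
  [exists B in K, exists sigma in B, exists tau in B,
     is_order_perm u sigma && is_order_perm v tau].

(* phi = a u b and psi = a v b with size a = k and size u = size v = c; see
   K_stepP. *)
Definition K_step c (K : {set {set 'S_c}}) n (phi psi : 'S_n) : bool :=
  [exists k : 'I_n.+1,
    [&& take k (oneline phi) == take k (oneline psi),
        drop (k + c) (oneline phi) == drop (k + c) (oneline psi)
      & order_perms_together K (take c (drop k (oneline phi)))
                               (take c (drop k (oneline psi)))]].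

Lemma K_stepP c (K : {set {set 'S_c}}) n (phi psi : 'S_n) :
  reflect (exists a u v b : seq nat,
             [/\ oneline phi = a ++ u ++ b, oneline psi = a ++ v ++ b,
                 size u = c, size v = c & order_perms_together K u v])
          (K_step K phi psi).
Proof.
apply: (iffP existsP) => [[k /and3P[/eqP eqa /eqP eqb Kuv]]|].
  exists (take k (oneline phi)), (take c (drop k (oneline phi))).
  exists (take c (drop k (oneline psi))), (drop (k + c) (oneline phi)).
  have split3 (w : seq nat) :
      w = take k w ++ take c (drop k w) ++ drop (k + c) w.
    by rewrite addnC -drop_drop !cat_take_drop.
  split=> //.
  - by rewrite eqa eqb; exact: split3.
  - by case/exists_inP: Kuv => B _ /exists_inP[s _ /exists_inP[t _]];
       case/andP=> /andP[/eqP].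
  - by case/exists_inP: Kuv => B _ /exists_inP[s _ /exists_inP[t _]];
     case/andP=> _ /andP[/eqP].
case=> [a [u [v [b [e1 e2 su sv Kuv]]]]].
have ka : size a < n.+1.
  by rewrite ltnS -(size_oneline phi) e1 size_cat leq_addr.
have d x w : drop (size a) (a ++ x ++ w) = x ++ w by rewrite drop_size_cat.
exists (Ordinal ka) => /=; rewrite e1 e2 !take_size_cat // addnC -!drop_drop !d.
by rewrite !drop_size_cat // !take_size_cat // Kuv !eqxx.
Qed.

Lemma K_step_sym c (K : {set {set 'S_c}}) n : symmetric (@K_step c K n).
Proof.
have imp (phi psi : 'S_n) : K_step K phi psi -> K_step K psi phi; last first.
  by move=> phi psi; apply/idP/idP; exact: imp.
move/K_stepP=> [a [u [v [b [e1 e2 su sv Kuv]]]]].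
apply/K_stepP; exists a, v, u, b; split=> //.
case/exists_inP: Kuv => B BK /exists_inP[s sB /exists_inP[t tB /andP[us vt]]].
apply/exists_inP; exists B => //; apply/exists_inP; exists t => //.
by apply/exists_inP; exists s => //; rewrite us vt.
Qed.

(* K_step is symmetric, so its reflexive transitive closure is the equivalence
   relation it generates. *)
Definition K_equiv c (K : {set {set 'S_c}}) n : rel 'S_n := connect (@K_step c K n).

Lemma K_equiv_rel c (K : {set {set 'S_c}}) n : equivalence_rel (@K_equiv c K n).
Proof.
apply/equivalence_relP; split; first exact: connect0.
exact: same_connect (sym_connect_sym (@K_step_sym c K n)).
Qed.

Definition K_classes c (K : {set {set 'S_c}}) n : {set {set 'S_n}} :=
  equivalence_partition (@K_equiv c K n) [set: 'S_n].

Definition add_singletons (T : finType) (P : {set {set T}}) : {set {set T}} :=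
  P :|: [set [set x] | x in ~: cover P].

Lemma add_singletons_partition (T : finType) (P : {set {set T}}) :
  trivIset P -> set0 \notin P -> partition (add_singletons P) [set: T].
Proof.
move=> tP nP; apply/and3P; split.
- rewrite eqEsubset subsetT /=; apply/subsetP => x _; apply/bigcupP.
  have [/bigcupP[B BP xB]|xP] := boolP (x \in cover P).
    by exists B => //; rewrite inE BP.
  by exists [set x]; rewrite ?set11 // inE imset_f ?orbT // inE.
- have out B x : B \in P -> x \notin cover P -> [disjoint B & [set x]].
    move=> BP xP; rewrite disjoint_sym disjoints1; apply: contra xP => xB.
    by apply/bigcupP; exists B.
  apply/trivIsetP => A B; rewrite !inE => /orP[AP|/imsetP[x xP ->]];
    case/orP=> [BP|/imsetP[y yP ->]] neq.
  + by move/trivIsetP: tP; exact.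
  + by apply: out => //; rewrite inE in yP.
  + by rewrite disjoint_sym; apply: out => //; rewrite inE in xP.
  + by rewrite disjoints1 inE; apply: contraNneq neq => ->.
- rewrite inE negb_or nP /=; apply/imsetP => -[x _ e].
  by have := set11 x; rewrite -e inE.
Qed.

Definition of_onelines c (ws : seq (seq nat)) : {set 'S_c} :=
  [set s | oneline s \in ws].

(* {123,231}{321,213} *)
Definition K_123_231__321_213 : {set {set 'S_3}} :=
  add_singletons [set of_onelines 3 [:: [:: 1; 2; 3]; [:: 2; 3; 1]];
                      of_onelines 3 [:: [:: 3; 2; 1]; [:: 2; 1; 3]]].

Lemma oneline3 (s : 'S_3) :
  oneline s = [:: (s ord0).+1; (s (inord 1)).+1; (s (inord 2)).+1].
Proof.
rewrite /oneline !enum_ordSl enum_ord0 /=.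
by congr [:: _; (s _).+1; (s _).+1]; apply/val_inj; rewrite /= inordK.
Qed.

Lemma K_123_231__321_213_partition :
  partition K_123_231__321_213 [set: 'S_3].
Proof.
have e1 : oneline (1%g : 'S_3) = [:: 1; 2; 3].
  by rewrite oneline3 !perm1 !inordK.
have e2 : oneline (tperm ord0 (inord 2) : 'S_3) = [:: 3; 2; 1].
  rewrite oneline3 tpermL tpermR tpermD ?inordK //;
  by rewrite -val_eqE /= !inordK.
apply: add_singletons_partition.
  apply/trivIsetP => A B; rewrite !inE.
  have dis : [disjoint of_onelines 3 [:: [:: 1; 2; 3]; [:: 2; 3; 1]]
                     & of_onelines 3 [:: [:: 3; 2; 1]; [:: 2; 1; 3]]].
    apply/pred0P => s; rewrite /= !inE.
    by apply/negP => /andP[/orP[] /eqP->].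
  by case/orP=> /eqP-> /orP[] /eqP->; rewrite ?eqxx // disjoint_sym.
rewrite !inE negb_or; apply/andP; split; rewrite eq_sym; apply/set0Pn.
  by exists 1%g; rewrite inE e1.
by exists (tperm ord0 (inord 2)); rewrite inE e2.
Qed.

(* Main.v *)
Require Import Defs.
From mathcomp Require Import all_boot all_fingroup.
From mathcomp Require Import zify.

(** Two one-line words are related by a step of the K-equivalence when three
    consecutive letters [x y z], increasing or decreasing, are replaced by
    [y z x], or conversely. These rotations are 3-cycles of places, so the parity
    of a permutation is an invariant, and they make sense for words of distinct
    letters with any set of letters.

    For [n >= 6] there is one big class for each parity, and all the other
    classes are small and explicit. A small word goes up or down. Going up, either
    it starts with its least letter followed by a small word that goes down, in
    which case the first letter never moves; or it is a hopping word, that is an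
    alternating word 2 n 3 (n-1) ... in which the letter 1 jumps over pairs of
    letters (if [n] is even, the last three letters of the alternating word may
    also be increasing); or [n = 5] and it is one of the seven words of the class
    of 13245. Small words are closed under rotations ([dsmall_rot3]), and the
    classes that they form have representatives [reps].

    That all other words of the same parity are equivalent ([connected_all]) is
    proved by induction on the length. By the dichotomy ([dichotomy]), a word that
    is not small is equivalent to some [a u] with [u] not small: if [u] is small,
    it can be given a normal form, and in each case a few rotations make [a] enter
    the word and destroy the normal form of the tail, unless the whole word is
    small. By induction the tail [u] can be rearranged at will, within its parity,
    into a non-small word that lets a rotation bring to the front a given letter
    with three smaller and three larger ones ([move_first]); two words with the
    same first letter are then compared by their tails. Length 6, and the
    dichotomy in length 7, are checked by computation.

    In each direction, going from [n] to [n + 1] letters, for [n >= 5], adds the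
    hopping class, and a second one if [n + 1] is even, to the classes with a
    fixed first letter. As there are 6 small classes in each direction for
    [n = 5], there are [n + n./2 - 1] of them for every [n >= 5], and
    [2 * (n + n./2)] classes in all for [n >= 6]. The representatives are
    pairwise inequivalent, since fixed first letters can be removed
    ([eqv_min_tail]), the first letter of a hopping word moves
    ([hop_reps_move]), and two classes of hopping words on the same letters
    differ by the parity ([hop_reps_parity]). *)

Set Implicit Arguments.
Unset Strict Implicit.
Unset Printing Implicit Defensive.

(** * Directed comparison of letters *)

(** The order on letters is used in both directions: [dlt true] is the usual
    strict order and [dlt false] its reverse. Rotations are insensitive to
    this reversal, so that every statement parametrized by a direction [d]
    stands for two mirror statements. *)
Definition dlt (d : bool) (x y : nat) := if d then x < y else y < x.

Lemma dltN d x y : dlt (~~ d) x y = dlt d y x. Proof. by case: d. Qed.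
Lemma dlt_irr d x : dlt d x x = false. Proof. by case: d; rewrite /= ltnn. Qed.
Lemma dlt_trans d y x z : dlt d x y -> dlt d y z -> dlt d x z.
Proof. by case: d => /=; lia. Qed.
Lemma dlt_asym d x y : dlt d x y -> dlt d y x = false.
Proof. by case: d => /=; lia. Qed.
Lemma dlt_total d x y : x != y -> dlt d x y || dlt d y x.
Proof. by case: d => /=; lia. Qed.

(** Decides a goal from the comparisons [dlt] in the context, by cases on all
    directions. *)
Ltac order :=
  repeat match goal with H : is_true (dlt _ _ _) |- _ => revert H end; clear;
  repeat match goal with d : bool |- _ => destruct d end; simpl; lia.

(** Arithmetic on the lengths of explicit words. *)
Ltac sizes :=
  repeat match goal with
    | H : is_true (leq _ _) |- _ => revert H | H : @eq nat _ _ |- _ => revert H end;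
  clear; simpl; lia.

(** [x] precedes all the letters of [u] in direction [d]. *)
Definition ext d (x : nat) (u : seq nat) := all (dlt d x) u.

(** * Rotations and their equivalence *)

(** One elementary move: three consecutive letters [x y z], increasing or
    decreasing, are replaced by [y z x], or conversely. *)
Inductive rot3 : seq nat -> seq nat -> Prop :=
| Rot_fwd d x y z t : dlt d x y -> dlt d y z -> rot3 [:: x, y, z & t] [:: y, z, x & t]
| Rot_bwd d x y z t : dlt d x y -> dlt d y z -> rot3 [:: y, z, x & t] [:: x, y, z & t]
| Rot_cons x u v : rot3 u v -> rot3 (x :: u) (x :: v).

(** The equivalence on words generated by rotations; [rot3] being symmetric, its
    reflexive transitive closure suffices. *)
Inductive eqv : seq nat -> seq nat -> Prop :=
| Eqv_refl u : eqv u u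
| Eqv_step v u w : rot3 u v -> eqv v w -> eqv u w.

Lemma rot3_sym u v : rot3 u v -> rot3 v u.
Proof.
elim=> [d x y z t xy yz|d x y z t xy yz|x u' v' _]; last exact: Rot_cons.
  exact: (Rot_bwd _ xy yz).
exact: (Rot_fwd _ xy yz).
Qed.

Lemma eqv_trans v u w : eqv u v -> eqv v w -> eqv u w.
Proof. by elim=> // v' u' w' uv _ IH /IH; apply: Eqv_step. Qed.

Lemma eqv_rot3 u v : rot3 u v -> eqv u v.
Proof. by move=> uv; apply: Eqv_step uv (Eqv_refl _). Qed.

Lemma eqv_sym u v : eqv u v -> eqv v u.
Proof.
elim=> [w|v' u' w uv _ IH]; first exact: Eqv_refl.
exact: eqv_trans IH (eqv_rot3 (rot3_sym uv)).
Qed.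

Lemma eqv_cons x u v : eqv u v -> eqv (x :: u) (x :: v).
Proof.
elim=> [w|v' u' w uv _ IH]; first exact: Eqv_refl.
exact: Eqv_step (Rot_cons x uv) IH.
Qed.

Lemma eqv_fwd d x y z t : dlt d x y -> dlt d y z ->
  eqv [:: x, y, z & t] [:: y, z, x & t].
Proof. by move=> xy yz; apply/eqv_rot3/(Rot_fwd _ xy yz). Qed.

Lemma eqv_bwd d x y z t : dlt d x y -> dlt d y z ->
  eqv [:: y, z, x & t] [:: x, y, z & t].
Proof. by move=> xy yz; apply/eqv_rot3/(Rot_bwd _ xy yz). Qed.

Lemma rot3_perm u v : rot3 u v -> perm_eq u v.
Proof.
elim=> [d x y z t _ _|d x y z t _ _|x u' v' _ IH]; last by rewrite perm_cons.
  by apply/seq.permP => p /=; lia.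
by apply/seq.permP => p /=; lia.
Qed.

Lemma eqv_perm u v : eqv u v -> perm_eq u v.
Proof. by elim=> // v' u' w /rot3_perm uv _; apply: perm_trans. Qed.

Lemma eqv_size u v : eqv u v -> size u = size v.
Proof. by move/eqv_perm/perm_size. Qed.

Lemma eqv_uniq u v : eqv u v -> uniq u = uniq v.
Proof. by move/eqv_perm/perm_uniq. Qed.

Lemma ext_perm d x u v : perm_eq u v -> ext d x u = ext d x v.
Proof. by move=> uv; apply: perm_all. Qed.

Lemma ext_mem d x u y : ext d x u -> y \in u -> dlt d x y.
Proof. by move=> /allP; apply. Qed.

(** The parity of the number of inversions. A rotation is a 3-cycle of places, so
    it preserves the parity. *)
Fixpoint inv_parity (w : seq nat) : bool :=
  if w is x :: u then odd (count (ltn^~ x) u) (+) inv_parity u else false.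

Lemma rotation_parity d x y z t : dlt d x y -> dlt d y z ->
  inv_parity [:: x, y, z & t] = inv_parity [:: y, z, x & t].
Proof.
move=> xy yz.
have cmp a b : dlt d a b -> ((a < b) = d) * ((b < a) = ~~ d).
  by case: {xy yz} d => /= ab; split; rewrite ?ab //; lia.
have xz := dlt_trans xy yz.
rewrite /= !oddD !(cmp _ _ xy) !(cmp _ _ yz) !(cmp _ _ xz).
case: (odd (count _ _)); case: (odd (count _ _)); case: (odd (count _ _));
by case: d {xy yz xz cmp}; case: inv_parity.
Qed.

Lemma rot3_parity u v : rot3 u v -> inv_parity u = inv_parity v.
Proof.
elim=> [d x y z t xy yz|d x y z t xy yz|x u' v' uv /= ->].
- exact: rotation_parity xy yz.
- by rewrite (rotation_parity _ xy yz).
- by rewrite (seq.permP (rot3_perm uv)).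
Qed.

Lemma eqv_parity u v : eqv u v -> inv_parity u = inv_parity v.
Proof. by elim=> // v' u' w /rot3_parity-> _. Qed.

(** * Small words *)

Definition dsorted d w := sorted (dlt d) w.
Arguments dsorted : simpl never.

(** The words that a hopping letter runs through: an alternation smallest,
    largest, second smallest, ... (for the direction [d]), except that the last
    three letters, when the length is odd, may also form one of the patterns 123
    and 231. *)
Fixpoint core d (z : seq nat) : bool :=
  match z with
  | [::] | [:: _] => true
  | [:: x; y; t] => [|| dsorted d [:: x; y; t], dsorted d [:: t; x; y] | dsorted d [:: x; t; y]]
  | x :: (y :: v) as z' => [&& ext d x z', ext (~~ d) y v & core d v]
  end.

(** Three words of length 4, of patterns 2314, 3412 and 2431, which belong to the
    class of 1234 and which the two general clauses of [hop] do not produce. *)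
Definition hop4 d (w : seq nat) : bool :=
  if w is [:: a; b; c; e] then
    [|| dsorted d [:: c; a; b; e], dsorted d [:: c; e; a; b] | dsorted d [:: e; a; c; b]]
  else false.

(** The hopping words: the extreme letter [h] is inserted at an even place of a
    word [x1 y1 x2 y2 ...] of [core]; it jumps over [xi yi] since [h < xi < yi].
    Apart from the words of length 4 above, either [h] comes first, or the word
    is [x y u] with [u] a hopping word, [y] the largest letter, and [h] the only
    letter smaller than [x]; sizes are meant for [d = true]. *)
Fixpoint hop d (w : seq nat) : bool :=
  match w with
  | [::] => false
  | [:: _] => true
  | x :: (y :: u) as w' =>
    [|| ext d x w' && core d w',
        [&& dlt d x y, ext (~~ d) y u, count (dlt d ^~ x) u == 1 & hop d u]
      | hop4 d w]
  end.

(** The seven words of the class of 13245, an exceptional class in length 5. *)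
Definition hop5 d (w : seq nat) : bool :=
  if w is [:: a; b; c; e; f] then
    has (dsorted d) [:: [:: a; c; b; e; f]; [:: a; e; c; b; f]; [:: a; f; e; b; c];
      [:: e; f; a; c; b]; [:: c; f; e; a; b]; [:: c; f; a; b; e];
      [:: a; f; b; c; e]]
  else false.

(** The words of the small classes of direction [d]: an extreme first letter
    which never moves, followed by a small word of the other direction; or a
    hopping word; or a word of the exceptional class of length 5. All of them
    start with a step of direction [d]. *)
Fixpoint dsmall d (w : seq nat) : bool :=
  match w with
  | [::] => false
  | [:: _] => true
  | x :: u => [|| ext d x u && dsmall (~~ d) u, hop d w | hop5 d w]
  end.

Lemma dsmallE d x y u : dsmall d [:: x, y & u] =
  [|| ext d x (y :: u) && dsmall (~~ d) (y :: u), hop d [:: x, y & u] | hop5 d [:: x, y & u]].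
Proof. by []. Qed.

(** The words of the small classes, in either direction. *)
Definition small w := dsmall true w || dsmall false w.

Ltac split_or := repeat match goal with H : is_true (_ || _) |- _ => case/orP: H => H end.

Lemma core_up d x y u : core d [:: x, y & u] -> dlt d x y.
Proof.
case: u => [|z [|t u]] /=; first by rewrite !andbT.
  by rewrite /dsorted /= !andbT => /or3P[] /andP[? ?]; order.
by case/and3P => /andP[].
Qed.

Lemma hop_up d x y u : hop d [:: x, y & u] -> dlt d x y.
Proof.
case/or3P => [/andP[/andP[]]|/and4P[]|] //.
case: u => [|z [|t [|? ?]]] //=; rewrite /dsorted /= !andbT.
by move=> /or3P[] /and3P[? ? ?]; order.
Qed.

(** A small word of direction [d] starts with a step of that direction: the two
    directions are disjoint, and a fixed extreme first letter cannot be rotated. *)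
Lemma dsmall_up d x y u : dsmall d [:: x, y & u] -> dlt d x y.
Proof.
case/or3P => [/andP[/andP[]]|/hop_up|] //.
case: u => [|z [|t [|e [|? ?]]]] //=; rewrite /dsorted /= !andbT.
by rewrite orbF ?andbT -?orbA => H; split_or; case/and4P: H => ? ? ? ?; order.
Qed.

(** * Reduction to the letters 0, ..., n-1 *)

(** Every word of distinct letters is the image of a permutation of [0, ..., n-1]
    under an increasing map. *)
Lemma standardize (w : seq nat) : uniq w -> exists f p,
  [/\ {homo f : x y / x < y}, perm_eq p (iota 0 (size w)) & w = map f p].
Proof.
move=> Uw; set s := sort leq w.
have ss : sorted ltn s by rewrite ltn_sorted_uniq_leq sort_uniq Uw sort_sorted //; exact: leq_total.
have ps : perm_eq s w by rewrite perm_sort.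
have sz : size s = size w := perm_size ps.
exists (fun x => if x < size w then nth 0 s x else \max_(y <- s) y + x).
exists (map (index^~ s) w); split.
- move=> x y xy; case: ifPn => xn; case: ifPn => yn; try lia.
    by apply: (sorted_ltn_nth ltn_trans) => //; rewrite inE sz.
  have : nth 0 s x <= \max_(y <- s) y.
    by apply: leq_bigmax_seq => //; rewrite mem_nth ?sz.
  by lia.
- rewrite -sz; apply: perm_trans (perm_map _ (_ : perm_eq w s)) _.
    by rewrite perm_sym.
  suff -> : map (index^~ s) s = iota 0 (size s) by [].
  apply: (@eq_from_nth _ 0); rewrite ?size_map ?size_iota // => i si.
  by rewrite (nth_map 0) // nth_iota // index_uniq // sort_uniq.
- rewrite -map_comp -[LHS]map_id; apply/eq_in_map => x xw /=.
  have xs : x \in s by rewrite (perm_mem ps).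
  by rewrite -sz index_mem xs nth_index.
Qed.

(** All the notions above are invariant under increasing relabellings. *)
Section Monotone.
Variables (f : nat -> nat) (fP : {homo f : x y / x < y}).

Lemma dlt_homo d x y : dlt d (f x) (f y) = dlt d x y.
Proof.
have fm : {mono f : x y / x < y}.
  move=> a b; apply/idP/idP => [|/fP //]; apply: contraTT; rewrite -!leqNgt.
  by rewrite leq_eqVlt => /orP[/eqP->//|/fP]; lia.
by case: d; rewrite /= fm.
Qed.

Lemma ext_map d x w : ext d (f x) (map f w) = ext d x w.
Proof. by rewrite /ext all_map; apply: eq_all => y /=; rewrite dlt_homo. Qed.

Lemma core_map d w : core d (map f w) = core d w.
Proof.
have [n] := ubnP (size w); elim: n w => // n IH [|x [|y [|z [|t w]]]] //= sw.
- by rewrite !dlt_homo.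
- by rewrite /dsorted /= !dlt_homo.
- have := IH [:: z, t & w]; rewrite /= => -> //; last by lia.
  by rewrite !dlt_homo !ext_map.
Qed.

Lemma hop_map d w : hop d (map f w) = hop d w.
Proof.
have [n] := ubnP (size w); elim: n w => // n IH [|x [|y u]] // sw.
change (hop d (f x :: f y :: map f u) = hop d (x :: y :: u)).
rewrite /hop -/(hop d _) -!map_cons ext_map core_map dlt_homo ext_map count_map.
rewrite IH; last by move: sw => /=; lia.
congr [|| _, [&& _, _, _ == _ & _] | _].
  by apply: eq_count => z /=; rewrite dlt_homo.
by case: u {sw} => [|? [|? [|? ?]]] //=; rewrite /dsorted /= !dlt_homo.
Qed.

Lemma dsmall_map d w : dsmall d (map f w) = dsmall d w.
Proof.
elim: w d => // x [//|y u] IH d.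
rewrite 2!map_cons dsmallE -map_cons IH ext_map -map_cons hop_map dsmallE.
congr [|| _, _ | _].
by case: u {IH} => [|? [|? [|? [|? ?]]]] //=; rewrite /dsorted /= !dlt_homo.
Qed.

Lemma small_map w : small (map f w) = small w.
Proof. by rewrite /small !dsmall_map. Qed.

Lemma inv_parity_map w : inv_parity (map f w) = inv_parity w.
Proof.
elim: w => //= x u ->; rewrite count_map; congr (odd _ (+) _).
by apply: eq_count => y /=; exact: (dlt_homo true).
Qed.

Lemma rot3_map u v : rot3 u v -> rot3 (map f u) (map f v).
Proof.
elim=> [d x y z t xy yz|d x y z t xy yz|x u' v' _]; last exact: Rot_cons.
  by apply: (@Rot_fwd d); rewrite dlt_homo.
by apply: (@Rot_bwd d); rewrite dlt_homo.
Qed.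

Lemma eqv_map u v : eqv u v -> eqv (map f u) (map f v).
Proof.
elim=> [w|v' u' w /rot3_map uv _]; first exact: Eqv_refl.
exact: Eqv_step.
Qed.

Lemma rot3_mapl u v : rot3 (map f u) v -> exists2 v', v = map f v' & rot3 u v'.
Proof.
move eu: (map f u) => u0 uv.
elim: uv u eu => [d x y z t xy yz|d x y z t xy yz|x u' v' _ IH] [|a [|b [|c u]]] //=.
- case=> ? ? ? ?; subst; exists [:: b, c, a & u] => //.
  by apply: (@Rot_fwd d); rewrite -dlt_homo.
- case=> ? ? ? ?; subst; exists [:: c, a, b & u] => //.
  by apply: (@Rot_bwd d); rewrite -dlt_homo.
- by case=> <- e; have [q -> uq] := IH [::] e; exists (a :: q) => //; apply: Rot_cons.
- by case=> <- e; have [q -> uq] := IH [:: b] e; exists (a :: q) => //; apply: Rot_cons.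
- by case=> <- e; have [q -> uq] := IH [:: b, c & u] e; exists (a :: q) => //; apply: Rot_cons.
Qed.

End Monotone.

(** The three letters are increasing or decreasing. *)
Definition mono3 x y z := ((x < y) && (y < z)) || ((z < y) && (y < x)).

(** The list of the words that are one rotation away from [w]. *)
Fixpoint nbrs (w : seq nat) : seq (seq nat) :=
  if w is x :: u then
    (if u is [:: y, z & t] then
       (if mono3 x y z then [:: [:: y, z, x & t]] else [::]) ++
       (if mono3 z x y then [:: [:: z, x, y & t]] else [::])
     else [::]) ++ map (cons x) (nbrs u)
  else [::].

Lemma mono3P x y z : reflect (exists2 d, dlt d x y & dlt d y z) (mono3 x y z).
Proof.
apply: (iffP orP) => [[/andP[xy yz]|/andP[zy yx]]|[[] xy yz]].
- by exists true.
- by exists false.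
- by left; apply/andP.
- by right; apply/andP; split.
Qed.

Lemma nbrsP w w' : reflect (rot3 w w') (w' \in nbrs w).
Proof.
apply: (iffP idP) => [|].
  elim: w w' => //= x u IH w'; rewrite mem_cat => /orP[|/mapP[v /IH uv ->]]; last first.
    exact: Rot_cons.
  case: u {IH} => [|y [|z t]] //; rewrite mem_cat.
  case: mono3P => [[d xy yz]|_]; case: mono3P => [[d' xy' yz']|_]; rewrite ?inE ?orbF //=.
  - by case/orP => /eqP->; [apply: Rot_fwd xy yz | apply: Rot_bwd xy' yz'].
  - by move/eqP->; apply: Rot_fwd xy yz.
  - by move/eqP->; apply: Rot_bwd xy' yz'.
elim=> [d x y z t xy yz|d x y z t xy yz|x u v _ IH] /=.
- by rewrite (introT (mono3P _ _ _)) ?mem_head //; exists d.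
- rewrite (introT (mono3P x y z)); last by exists d.
  by rewrite !mem_cat mem_head !orbT.
- by rewrite mem_cat map_f ?orbT.
Qed.

(** An exhaustive verification over the permutations of at most five letters. *)
Lemma rot3_small_check : all (fun k => all (fun p => all (fun q =>
  [&& core true p ==> core true q, core false p ==> core false q,
    hop true p ==> hop true q, hop false p ==> hop false q,
    dsmall true p ==> dsmall true q & dsmall false p ==> dsmall false q])
  (nbrs p)) (permutations (iota 0 k))) (iota 0 6).
Proof. by vm_compute. Qed.

Lemma rot3_small d (u v : seq nat) : uniq u -> size u <= 5 -> rot3 u v ->
  [/\ core d u -> core d v, hop d u -> hop d v & dsmall d u -> dsmall d v].
Proof.
move=> Uu su uv; have [f [p [fP pp eu]]] := standardize Uu; subst u.
have [q -> pq] := rot3_mapl fP uv.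
rewrite !core_map ?hop_map ?dsmall_map //.
have /allP/(_ (size p)) := rot3_small_check.
rewrite mem_iota /= ltnS -(size_map f) => /(_ su) /allP/(_ p).
rewrite mem_permutations pp => /(_ isT) /allP/(_ q); move/nbrsP: pq => -> /(_ isT).
by case/and5P => /implyP ? /implyP ? /implyP ? /implyP ? /andP[/implyP ? /implyP ?]; case: d.
Qed.

(** * Rotations preserve smallness *)

(** The three ways of rotating a word with first letter [x]: inside the tail, or
    at the head in one of the two senses. *)
Variant rot3_cons_spec x u : seq nat -> Prop :=
| Rot3Tail v of rot3 u v : rot3_cons_spec x u (x :: v)
| Rot3Fwd e y z t of u = [:: y, z & t] & dlt e x y & dlt e y z :
    rot3_cons_spec x u [:: y, z, x & t]
| Rot3Bwd e y z t of u = [:: y, z & t] & dlt e z x & dlt e x y :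
    rot3_cons_spec x u [:: z, x, y & t].

Lemma rot3_consP x u w : rot3 (x :: u) w -> rot3_cons_spec x u w.
Proof.
move ew : (x :: u) => w0 h; case: h ew => [e a b c t ab bc|e a b c t ab bc|a u' v uv] [-> ->].
- exact: (Rot3Fwd _ ab bc).
- exact: (Rot3Bwd _ ab bc).
- exact: Rot3Tail.
Qed.

Lemma ext_cons d x y u : ext d x (y :: u) = dlt d x y && ext d x u.
Proof. by []. Qed.

Lemma ext_trans d x y u : dlt d x y -> ext d y u -> ext d x u.
Proof. by move=> xy; apply: sub_all => z; apply: dlt_trans. Qed.

Lemma core_cons d x y u : 1 < size u ->
  core d [:: x, y & u] = [&& ext d x (y :: u), ext (~~ d) y u & core d u].
Proof. by case: u => [|a [|b u]]. Qed.

Lemma hop_cons d x y u : 2 < size u -> hop d [:: x, y & u] =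
  (ext d x (y :: u) && core d (y :: u)) ||
  [&& dlt d x y, ext (~~ d) y u, count (dlt d ^~ x) u == 1 & hop d u].
Proof.
case: u => [|a [|b [|c u]]] // _.
by rewrite {1}/hop -/(hop d _) orbF.
Qed.

Lemma dsmall_cons d x u : 4 < size u ->
  dsmall d (x :: u) = (ext d x u && dsmall (~~ d) u) || hop d (x :: u).
Proof.
case: u => [|a [|b [|c [|e [|f u]]]]] // _.
by rewrite {1}/dsmall -/(dsmall _ _) orbF.
Qed.

Lemma core_rot3 d (u v : seq nat) : uniq u -> rot3 u v -> core d u -> core d v.
Proof.
have [n] := ubnP (size u); elim: n u v => // n IH u v su Uu uv.
have [s5|] := leqP (size u) 5; first by case: (rot3_small d Uu s5 uv).
case: u su Uu uv => [|x [|y u]] // su Uu uv su5.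
have {}su5 : 3 < size u by move: su5.
rewrite core_cons; last by rewrite ltnW // ltnW.
case/and3P; rewrite ext_cons => /andP[xy xu] yu cu.
have Uu' : uniq u by case/and3P: Uu.
case: u su su5 Uu xu yu cu Uu' uv => [|a [|b u]] // su su5 Uu xu yu cu Uu' uv.
have ab := core_up cu.
have [xa ya yb] : [/\ dlt d x a, dlt d a y & dlt d b y].
  by move: xu yu; rewrite !ext_cons !dltN => /andP[-> _] /and3P[-> -> _].
case/rot3_consP: uv => [w|e ? ? ? [<- <- <-]|e ? ? ? [<- <- <-]].
- case/rot3_consP => [w' uv|e ? ? ? [<- <- <-]|e ? ? ? [<- <- <-]].
  + have pw := rot3_perm uv.
    rewrite core_cons -?(perm_size pw); last by rewrite ltnW // ltnW.
    apply/and3P; split.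
    * by rewrite ext_cons xy -(ext_perm _ _ pw).
    * by rewrite -(ext_perm _ _ pw).
    * by apply: (IH _ _ _ Uu' uv cu); sizes.
  + by move=> ? ?; exfalso; order.
  + by move=> ? ?; exfalso; order.
- by move=> ? ?; exfalso; order.
- by move=> ? ?; exfalso; order.
Qed.

Lemma ext_count0 d x u : ext d x u -> count (dlt d ^~ x) u = 0.
Proof.
move=> /allP xu; apply/eqP; rewrite -leqn0 leqNgt -has_count.
by apply/hasPn => y /xu xy; rewrite (dlt_asym xy).
Qed.

Lemma count0_ext d (x : nat) (u : seq nat) :
  x \notin u -> count (dlt d ^~ x) u = 0 -> ext d x u.
Proof.
move=> xu /eqP; rewrite -leqn0 leqNgt -has_count => /hasPn nu.
apply/allP => y yu; have /negbTE yx := nu y yu.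
have : x != y by apply: contraNneq xu => ->.
by move/(dlt_total d); rewrite yx orbF.
Qed.

Lemma hop_front d h u : ext d h u -> core d u -> hop d (h :: u).
Proof. by case: u => // y u; rewrite /hop -/(hop d _) => -> ->. Qed.

Lemma hop_core d h u : ext d h u -> hop d (h :: u) -> core d u.
Proof.
case: u => // y u hu; case/or3P => [/andP[]|/and4P[_ _]|] //.
  move: hu; rewrite ext_cons => /andP[_ /ext_count0->] //.
case: u hu => [|b [|c [|? ?]]] //=; rewrite /dsorted /= !andbT => /and3P[hy hb hc].
by case/or3P => /and3P[? ? ?]; exfalso; order.
Qed.

Lemma hop_rot3 d (u v : seq nat) : uniq u -> rot3 u v -> hop d u -> hop d v.
Proof.
have [n] := ubnP (size u); elim: n u v => // n IH u v su Uu uv.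
have [s5|] := leqP (size u) 5; first by case: (rot3_small d Uu s5 uv).
case: u su Uu uv => [|x [|y u]] // su Uu uv su5.
have {}su5 : 3 < size u by move: su5.
rewrite hop_cons; last by rewrite ltnW.
have Uu' : uniq u by case/and3P: Uu.
have yNu : y \notin u by case/and3P: Uu.
have xNu : x \notin u by case/andP: Uu; rewrite inE negb_or => /andP[].
case/orP.
  rewrite ext_cons => /andP[/andP[xy xu] cyu].
  case: u su Uu uv su5 Uu' yNu xNu xu cyu => // a u su Uu uv su5 Uu' yNu xNu xu cyu.
  have ya := core_up cyu.
  have xa : dlt d x a by move: xu; rewrite ext_cons => /andP[].
  case/rot3_consP: uv => [w uv|e ? ? ? [<- <- <-] _ _|e ? ? ? [<- <- <-] ? ?].
  - have pw := rot3_perm uv.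
    apply: hop_front; first by rewrite -(ext_perm _ _ pw) ext_cons xy.
    by apply: core_rot3 uv cyu; case/andP: Uu.
  - move: cyu; rewrite core_cons ?ext_cons; last exact: ltnW.
    move=> /and3P[/andP[_ yu] au cu].
    rewrite hop_cons; last exact: ltnW su5.
    apply/orP; right; apply/and4P; split=> //.
    + by rewrite ext_cons dltN xa.
    + by rewrite /= xy (ext_count0 yu).
    + by apply: hop_front => //; move: xu; rewrite ext_cons => /andP[].
  - by exfalso; order.
case/and4P => xy yu cx hu.
case: u su Uu uv su5 Uu' yNu xNu yu cx hu => [|a [|b u]] // su Uu uv su5 Uu' yNu xNu yu cx hu.
have ab := hop_up hu.
have [ya yb] : dlt d a y /\ dlt d b y.
  by move: yu; rewrite !ext_cons !dltN => /and3P[].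
case/rot3_consP: uv => [w uv|e ? ? ? [<- <- <-] ? ?|e ? ? ? [<- <- <-] ? ?].
- case/rot3_consP: uv => [w' uv|e ? ? ? [<- <- <-] ? ?|e ? ? ? [<- <- <-] ? ?].
  + have pw := rot3_perm uv.
    rewrite hop_cons -?(perm_size pw) 1?ltnW //; apply/orP; right.
    rewrite xy -(ext_perm _ _ pw) yu -(seq.permP pw) cx /=.
    by apply: (IH _ _ _ Uu' uv hu); sizes.
  + by exfalso; order.
  + by exfalso; order.
- by exfalso; order.
- have ax : dlt d a x by order.
  have {}cx : count (dlt d ^~ x) (b :: u) = 0.
    by move: cx; rewrite [count _ _]/= ax => /eqP[].
  have xbu : ext d x (b :: u).
    by apply: count0_ext => //; apply: contraNN xNu => xbu; rewrite in_cons xbu orbT.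
  have abu := ext_trans ax xbu.
  apply: hop_front; first by rewrite !ext_cons ax (dlt_trans ax xy).
  rewrite core_cons; last exact: ltnW su5.
  apply/and3P; split.
  + by rewrite ext_cons xy.
  + by move: yu; rewrite ext_cons => /andP[].
  + exact: hop_core hu.
Qed.

Lemma hop_dsmall d u : hop d u -> dsmall d u.
Proof. by case: u => // x [//|y u] hu; rewrite dsmallE hu orbT. Qed.

Lemma dsmall_front d x u : ext d x u -> dsmall (~~ d) u -> dsmall d (x :: u).
Proof. by case: u => // y u xu su; rewrite dsmallE xu su. Qed.

(** In a small word of length at least 6 that starts with an extreme letter
    followed by a small word of the other direction, the head triple is not
    monotone, so that rotations only take place in the tail. *)
Lemma dsmall_rot3 d (u v : seq nat) : uniq u -> rot3 u v -> dsmall d u -> dsmall d v.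
Proof.
have [n] := ubnP (size u); elim: n u v d => // n IH u v d su Uu uv.
have [s5|] := leqP (size u) 5; first by case: (rot3_small d Uu s5 uv).
case: u su Uu uv => // x u su Uu uv su5.
rewrite dsmall_cons //; case/orP => [/andP[]|hu]; last exact/hop_dsmall/(hop_rot3 Uu uv).
have Uu' : uniq u by case/andP: Uu.
case/rot3_consP: uv => [w uv xu smu|e a b t -> xa ab|e a b t -> bx xa].
- apply: dsmall_front; first by rewrite -(ext_perm _ _ (rot3_perm uv)).
  by apply: IH uv smu => //; sizes.
- by rewrite !ext_cons => /and3P[? ? ?] /dsmall_up; rewrite dltN => ?; exfalso; order.
- by rewrite !ext_cons => /and3P[? ? ?] /dsmall_up; rewrite dltN => ?; exfalso; order.
Qed.

Lemma dsmall_eqv d (u v : seq nat) : uniq u -> eqv u v -> dsmall d u -> dsmall d v.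
Proof.
move=> Uu uv; elim: uv Uu => // v' u' w uv _ IH Uu /(dsmall_rot3 Uu uv); apply: IH.
by rewrite -(perm_uniq (rot3_perm uv)).
Qed.

Lemma small_eqv (u v : seq nat) : uniq u -> eqv u v -> small u -> small v.
Proof.
by move=> Uu uv /orP[/(dsmall_eqv Uu uv)|/(dsmall_eqv Uu uv)]; rewrite /small => ->; rewrite ?orbT.
Qed.

(** The extreme first letter of a small word of the first kind never moves: the
    class of [x :: u] is obtained by putting [x] in front of the class of [u]. *)
Lemma eqv_min_tail d x (u w : seq nat) : uniq (x :: u) -> ext d x u -> dsmall (~~ d) u ->
  eqv (x :: u) w -> exists2 v, w = x :: v & eqv u v.
Proof.
move eu : (x :: u) => u0 Uu xu smu uw.
elim: uw u eu Uu xu smu => [w' u <- *|v' u' w' uv _ IH u eu Uu xu smu].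
  by exists u => //; exact: Eqv_refl.
rewrite -{}eu in uv Uu.
have [v ev uv1] : exists2 v, v' = x :: v & rot3 u v.
  case/rot3_consP: uv xu smu {Uu} => [v uv _ _|e a b t -> xa ab|e a b t -> xa ab].
  - by exists v.
  - by rewrite !ext_cons => /and3P[? ? ?] /dsmall_up; rewrite dltN => ?; exfalso; order.
  - by rewrite !ext_cons => /and3P[? ? ?] /dsmall_up; rewrite dltN => ?; exfalso; order.
have pv := rot3_perm uv1; have Uu' : uniq u by case/andP: Uu.
subst v'; have [||||v2 -> vv2] := IH v => //.
- by rewrite -(perm_uniq (rot3_perm uv)).
- by rewrite -(ext_perm _ _ pv).
- exact: dsmall_rot3 uv1 smu.
- by exists v2 => //; apply: Eqv_step vv2.
Qed.

(** * The dichotomy: small words and words with a non-small tail *)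

Lemma core_front d x y u :
  ext d x (y :: u) -> ext (~~ d) y u -> core d u -> core d [:: x, y & u].
Proof.
case: u => [|a [|b u]] xu yu cu; last by rewrite core_cons // xu yu.
  exact/and3P.
move: xu yu; rewrite !ext_cons dltN => /and3P[xy xa _] /andP[ay _].
by rewrite /= /dsorted /= xa ay !orbT.
Qed.

(** The hopping letter can be brought to the front. *)
Lemma hop_rep d (u : seq nat) : uniq u -> hop d u ->
  exists h z, [/\ eqv u (h :: z), ext d h z & core d z].
Proof.
have [n] := ubnP (size u); elim: n u => // n IH [|x [|y u]] // su Uu.
  by move=> _; exists x, [::]; split=> //; exact: Eqv_refl.
case/or3P=> [/andP[xu cu]|/and4P[xy yu cx hu]|].
- by exists x, (y :: u); split=> //; exact: Eqv_refl.
- have Uu' : uniq u by case/and3P: Uu.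
  have xNu : x \notin u by case/andP: Uu; rewrite in_cons negb_or => /andP[].
  have [|h [z [uhz hz cz]]] := IH u _ Uu' hu; first by sizes.
  have phz := eqv_perm uhz.
  move: xNu cx yu; rewrite (perm_mem phz) (seq.permP phz) (ext_perm _ _ phz) in_cons.
  rewrite negb_or ext_cons dltN => /andP[xh xz] /= cx /andP[hy yz].
  have hx : dlt d h x.
    case/orP: (dlt_total d xh) => // xh'.
    by move: cx; rewrite (dlt_asym xh') (ext_count0 (ext_trans xh' hz)).
  have {}xz : ext d x z by apply: count0_ext => //; move: cx; rewrite hx => /eqP[].
  exists h, [:: x, y & z]; split.
  + apply: eqv_trans (eqv_bwd z hx xy).
    by do 2!apply: eqv_cons.
  + by rewrite !ext_cons hx (dlt_trans hx xy).
  + by apply: core_front; rewrite ?ext_cons ?xy.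
- case: u su Uu => [|b [|c [|? ?]]] //= _ _; rewrite /dsorted /= !andbT.
  case/or3P=> /and3P[? ? ?].
  + exists b, [:: x; y; c]; split; first exact: (@eqv_bwd d).
      by rewrite !ext_cons; apply/and4P; split => //; order.
    by rewrite /= /dsorted /= !andbT; apply/or3P/Or31/andP.
  + exists b, [:: x; y; c]; split; first by apply: (@eqv_bwd d) => //; order.
      by rewrite !ext_cons; apply/and4P; split => //; order.
    by rewrite /= /dsorted /= !andbT; apply/or3P/Or32/andP.
  + exists c, [:: x; b; y]; split.
    * apply: (@eqv_trans [:: x; b; c; y]).
        by apply: eqv_cons; apply: (@eqv_fwd (~~ d)); order.
      by apply: (@eqv_bwd d); order.
    * by rewrite !ext_cons; apply/and4P; split => //; order.
    * by rewrite /= /dsorted /= !andbT; apply/or3P/Or31/andP.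
Qed.

(** A small word of length at least 6 is equivalent to one that starts with its
    extreme letter. *)
Lemma dsmall_rep d (u : seq nat) : uniq u -> 5 < size u -> dsmall d u ->
  exists h z, [/\ eqv u (h :: z), ext d h z & dsmall (~~ d) z \/ core d z].
Proof.
move=> Uu; case: u Uu => // x u Uu su; rewrite dsmall_cons // => /orP[/andP[xu smu]|hu].
  by exists x, u; split=> //; [exact: Eqv_refl | left].
by have [h [z [uz hz cz]]] := hop_rep Uu hu; exists h, z; split=> //; right.
Qed.

Lemma small_up d x y u : dlt d x y -> small [:: x, y & u] -> dsmall d [:: x, y & u].
Proof.
by rewrite /small => xy; case: d xy => xy /orP[] // /dsmall_up yx; exfalso; order.
Qed.

Lemma dsmall_small d u : dsmall d u -> small u.
Proof. by rewrite /small; case: d => ->; rewrite ?orbT. Qed.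

Lemma dsmall_notmin d x y u : 3 < size u -> dsmall d [:: x, y & u] -> ~~ ext d x (y :: u) ->
  [/\ ext (~~ d) y u, count (dlt d ^~ x) u = 1 & hop d u].
Proof.
move=> su; rewrite dsmall_cons // => /orP[/andP[->] //|].
rewrite hop_cons; last exact: ltnW.
by move=> /orP[/andP[->] //|/and4P[_ ? /eqP ? ?]] _.
Qed.

(** Either [w] is small, or its class contains a word whose tail, without the
    first letter, is not small. *)
Definition small_or_escapes (w : seq nat) :=
  small w \/ exists a u, eqv w (a :: u) /\ ~~ small u.

Lemma escapes_eqv (w w' : seq nat) : uniq w -> eqv w w' ->
  small_or_escapes w' -> small_or_escapes w.
Proof.
move=> Uw ww' [sw'|[a [u [w'u nu]]]].
  by left; apply: (small_eqv _ (eqv_sym ww')) => //; rewrite -(eqv_uniq ww').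
by right; exists a, u; split=> //; exact: eqv_trans ww' w'u.
Qed.

Lemma escapes_try a u w : eqv w (a :: u) -> (small u -> small_or_escapes w) ->
  small_or_escapes w.
Proof.
move=> wu H; have [/H //|nu] := boolP (small u).
by right; exists a, u.
Qed.

(** The case of a word [a b c t] whose tail [b c t] is a small word of the first
    kind. If [d] is [true], [b] is the largest letter of [b c t] and [c] the
    smallest letter of the small word [c t]; the discussion is on the place of
    [a] with respect to [c] and [b]. *)
Lemma escapes_over d a b c t : uniq [:: a, b, c & t] -> 4 < size t ->
  ext (~~ d) b (c :: t) -> ext d c t -> dsmall (~~ d) t \/ core d t ->
  small_or_escapes [:: a, b, c & t].
Proof.
move=> Uw st bct ct smt.
have smct : dsmall d (c :: t).
  by case: smt => [|/hop_front/hop_dsmall->] //; exact: dsmall_front.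
have [ab ac] : a != b /\ a != c.
  by case/andP: Uw; rewrite !in_cons !negb_or => /and3P[].
have [cb bt] : dlt d c b /\ ext (~~ d) b t by move: bct; rewrite ext_cons dltN => /andP[].
(* If a < c, then a is the least letter of a word with a small tail. *)
case/orP: (dlt_total d ac) => [{}ac|ca].
  left; apply: (@dsmall_small d); apply: dsmall_front.
    by rewrite !ext_cons ac (dlt_trans ac cb) (ext_trans ac ct).
  by apply: dsmall_front => //; rewrite negbK.
case/orP: (dlt_total d ab) => [{}ab|ba]; last first.
  have eba : ext (~~ d) a (b :: c :: t).
    by rewrite ext_cons dltN ba; apply: ext_trans bct; rewrite dltN.
  case: smt => [smt|cot].
    (* Here a > b > c: a b c -> b c a. If the tail c a t is small, then a t is a
       hopping word, and so is a b c t. *)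
    apply: (@escapes_try b [:: c, a & t]).
      by apply: (@eqv_fwd (~~ d)); rewrite dltN.
    move/(small_up ca); rewrite dsmall_cons; last exact: ltnW.
    case/orP => [/andP[_]|].
      rewrite dsmall_cons // negbK => /orP[/andP[_ smt']|hat].
        case: t st smt smt' {Uw bct ct smct bt eba} => [|x [|y t]] // _ /dsmall_up + /dsmall_up.
        by rewrite dltN => ? ?; exfalso; order.
      left; apply: (@dsmall_small (~~ d)); apply/hop_dsmall/hop_front => //.
      apply: core_front => //; first by rewrite negbK.
      by apply: hop_core hat; move: eba; rewrite !ext_cons => /and3P[].
    rewrite hop_cons; last by rewrite ltnW // ltnW.
    case/orP => [/andP[_]|/and4P[_ _]]; last by rewrite (ext_count0 ct).
    case: t st eba {Uw bct ct smct bt smt} => // x t _.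
    by rewrite !ext_cons dltN => /and4P[_ _ ? _] /core_up ?; exfalso; order.
  case: t st Uw bct ct smct bt eba cot => [|x [|y t]] // st Uw bct ct smct bt eba cot.
  move: (cot); rewrite core_cons; last by rewrite ltnW //.
  rewrite ext_cons => /and3P[/andP[xy xt] yt cot'].
  have [cx cy] : dlt d c x /\ dlt d c y by move: ct; rewrite !ext_cons => /and3P[].
  have [xb yb] : dlt d x b /\ dlt d y b by move: bt; rewrite !ext_cons !dltN => /and3P[].
  (* With t = x y t', a b c x y t' -> a b x y c t' -> b x a y c t', whose tail is
     not small since y c goes down. *)
  apply: (@escapes_try b [:: x, a, y, c & t]).
    apply: (@eqv_trans [:: a, b, x, y, c & t]).
      by do 2!apply: eqv_cons; apply: (@eqv_fwd d).
    by apply: (@eqv_fwd (~~ d)); rewrite dltN.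
  move/(@small_up d) => /(_ (dlt_trans xb ba)) /dsmall_notmin [].
  - by sizes.
  - by rewrite !ext_cons; apply/negP => /and4P[_ _ ? _]; order.
  - by move=> _ _ /hop_up ?; exfalso; order.
(* From now on c < a < b, and a b c -> c a b. *)
apply: (@escapes_eqv _ [:: c, a, b & t]) => //; first exact: (@eqv_bwd d).
case: smt => [smt|cot].
  case: t st Uw bct ct smct bt smt => [|q [|p t]] // st Uw bct ct smct bt smt.
  have pq : dlt d p q by rewrite -dltN; exact: dsmall_up smt.
  have [cq cp] : dlt d c q /\ dlt d c p by move: ct; rewrite !ext_cons => /and3P[].
  have [qb pb] : dlt d q b /\ dlt d p b by move: bt; rewrite !ext_cons !dltN => /and3P[].
  (* With t = q p t' and p < q, the tail a b q p t' can only be small if a is its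
     least letter and p the least letter of p t'. *)
  apply: (@escapes_try c [:: a, b, q, p & t]); first exact: Eqv_refl.
  move/(small_up ab) => sm1.
  have [ea|ea] := boolP (ext d a [:: b, q, p & t]); last first.
    have [|_ _ /hop_up ?] := dsmall_notmin _ sm1 ea; first by sizes.
    by exfalso; order.
  move: sm1; rewrite dsmall_cons; last by sizes.
  case/orP => [/andP[_]|]; last first.
    rewrite hop_cons; last by sizes.
    case/orP => [/andP[_ /core_up ?]|/and4P[_ _]]; first by exfalso; order.
    by rewrite (ext_count0 (_ : ext d a [:: q, p & t])) //; move: ea; rewrite ext_cons => /andP[].
  rewrite dsmall_cons; last by sizes.
  case/orP => [/andP[_ /dsmall_up]|]; first by rewrite negbK => ?; exfalso; order.
  move/(hop_core bt); rewrite core_cons; last by sizes.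
  case/and3P => _; rewrite negbK => pt _.
  have aq : dlt d a q by move: ea; rewrite !ext_cons => /and3P[].
  (* In this case c a b q p t' -> c a q p b t' -> a q c p b t'. *)
  apply: (@escapes_try a [:: q, c, p, b & t]).
    apply: (@eqv_trans [:: c, a, q, p, b & t]).
      by do 2!apply: eqv_cons; apply: (@eqv_fwd (~~ d)); rewrite dltN.
    exact: (@eqv_fwd d).
  move/(@small_up (~~ d)); rewrite dltN => /(_ cq) /dsmall_notmin [].
  - by sizes.
  - by rewrite !ext_cons !dltN; apply/negP => /and4P[_ _ ? _]; order.
  - by move=> _ _ /hop_up; rewrite dltN => ?; exfalso; order.
case: t st Uw bct ct smct bt cot => [|x [|y t]] // st Uw bct ct smct bt cot.
move: (cot); rewrite core_cons; last by sizes.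
rewrite ext_cons => /and3P[/andP[xy xt] yt cot'].
have ax : a != x by case/andP: Uw; rewrite !in_cons !negb_or => /and4P[].
(* With t = x y t' in core, c a b x y t' is a hopping word if a < x. Otherwise, as
   a is not the least letter of the tail a b x y t', the latter could only be small
   if x y t' were a hopping word; but x is its least letter and y its largest. *)
case/orP: (dlt_total d ax) => [{}ax|xa].
  left; apply: (@dsmall_small d); apply/hop_dsmall/hop_front.
    by rewrite !ext_cons ca cb.
  by apply: core_front => //; rewrite !ext_cons ab ax (dlt_trans ax xy) (ext_trans ax xt).
apply: (@escapes_try c [:: a, b, x, y & t]); first exact: Eqv_refl.
move/(small_up ab) => /dsmall_notmin[].
- by sizes.
- by rewrite !ext_cons; apply/negP => /and4P[_ ? _]; order.
- move=> _ _ /hop_core; rewrite ext_cons xy => /(_ xt).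
  case: t st yt {Uw bct ct smct bt cot xt cot'} => // z t _.
  by rewrite ext_cons dltN => /andP[? _] /core_up ?; exfalso; order.
Qed.

(** The case of a word [a b b2 c t] whose tail is a hopping word, [b] being the
    hopping letter. If [d] is [true], [b] is the largest letter of the tail, [b2]
    the second largest one and [c] the smallest one. *)
Lemma escapes_hop d a b b2 c t : uniq [:: a, b, b2, c & t] -> 3 < size t ->
  ext (~~ d) b [:: b2, c & t] -> core (~~ d) [:: b2, c & t] ->
  small_or_escapes [:: a, b, b2, c & t].
Proof.
move=> Uw st bt cot.
case: t st Uw bt cot => // r t st Uw bt cot.
move: (cot); rewrite core_cons; last by sizes.
rewrite negbK => /and3P[b2t ct cot'].
have [b2b cb rb] : [/\ dlt d b2 b, dlt d c b & dlt d r b].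
  by move: bt; rewrite !ext_cons !dltN => /and4P[].
have [cb2 rb2] : dlt d c b2 /\ dlt d r b2.
  by move: b2t; rewrite !ext_cons !dltN => /and3P[].
have [ab ab2 ac] : [/\ a != b, a != b2 & a != c].
  by case/andP: Uw; rewrite !in_cons !negb_or => /and4P[].
case/orP: (dlt_total d ab) => [{}ab|ba]; last first.
  (* a b b2 -> b b2 a if a > b: the letter b2 is preceded by both c and r in the
     order, which no small word of this length allows for its first letter. *)
  apply: (@escapes_try b [:: b2, a, c, r & t]).
    by apply: (@eqv_fwd (~~ d)); rewrite dltN.
  move/(small_up (dlt_trans b2b ba)) => /dsmall_notmin[].
  - by sizes.
  - by rewrite !ext_cons; apply/negP => /and3P[_ ? _]; order.
  - by move=> _; rewrite /= cb2 rb2.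
case/orP: (dlt_total d ac) => [{}ac|ca].
  left; apply: (@dsmall_small d); apply: dsmall_front; last exact/hop_dsmall/hop_front.
  rewrite !ext_cons ab (dlt_trans ac cb2) ac; move: ct; rewrite ext_cons => /andP[cr ct].
  by rewrite (dlt_trans ac cr) (ext_trans ac ct).
have step1 : eqv [:: a, b, b2, c, r & t] [:: a, b2, c, b, r & t].
  by apply: eqv_cons; apply: (@eqv_fwd (~~ d)); rewrite dltN.
case/orP: (dlt_total d ab2) => [{}ab2|b2a].
  (* c < a < b2: a b2 c -> c a b2. *)
  apply: (@escapes_try c [:: a, b2, b, r & t]).
    by apply: eqv_trans step1 _; apply: (@eqv_bwd d).
  move/(small_up ab2); rewrite dsmall_cons; last by sizes.
  case/orP => [/andP[_ /dsmall_up]|]; first by rewrite dltN => ?; exfalso; order.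
  rewrite hop_cons; last by sizes.
  case/orP => [/andP[_]|/and4P[_]]; last first.
    by rewrite ext_cons dltN => /andP[? _]; exfalso; order.
  rewrite core_cons; last by sizes.
  by rewrite !ext_cons => /andP[/and3P[_ ? _]]; exfalso; order.
(* c < b2 < a: a b2 c -> b2 c a. *)
apply: (@escapes_try b2 [:: c, a, b, r & t]).
  by apply: eqv_trans step1 _; apply: (@eqv_fwd (~~ d)); rewrite dltN.
move/(small_up ca); rewrite dsmall_cons; last by sizes.
case/orP => [/andP[_ /dsmall_up]|]; first by rewrite dltN => ?; exfalso; order.
rewrite hop_cons; last by sizes.
case/orP => [/andP[_]|/and4P[_]]; last first.
  by rewrite ext_cons dltN => /andP[? _]; exfalso; order.
rewrite core_cons; last by sizes.
by rewrite !ext_cons => /andP[/and3P[_ ? _]]; exfalso; order.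
Qed.

Lemma dichotomy (w : seq nat) : uniq w -> 7 < size w -> small_or_escapes w.
Proof.
case: w => // a u Uw su.
have Uu : uniq u by case/andP: Uw.
apply: (@escapes_try a u); first exact: Eqv_refl.
move=> smu; have {smu} [d smu] : exists d, dsmall (~~ d) u.
  by case/orP: smu; [exists false | exists true].
have [|b [s [us bs smes]]] := dsmall_rep Uu _ smu; first by sizes.
have es := eqv_size us.
have aus : eqv (a :: u) [:: a, b & s] by apply: eqv_cons.
apply: (escapes_eqv Uw aus).
have Us : uniq [:: a, b & s] by rewrite -(eqv_uniq aus).
have ss : 5 < size s by sizes.
case: smes => [|cos].
  rewrite negbK => sms.
  have [|c [t [st ct smt]]] := dsmall_rep _ ss sms; first by case/and3P: Us.
  have abct : eqv [:: a, b & s] [:: a, b, c & t] by do 2!apply: eqv_cons.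
  apply: (escapes_eqv Us abct).
  apply: (@escapes_over d) => //.
  - by rewrite -(eqv_uniq abct).
  - by move: (eqv_size st) ss => ->.
  - by rewrite -(ext_perm _ _ (eqv_perm st)).
case: s ss Us bs cos {us es aus} => [|b2 [|c t]] // ss Us bs cos.
by apply: (@escapes_hop d).
Qed.

(** * Non-small words with the same letters and parity are equivalent *)

Lemma standardize2 (w w' : seq nat) : uniq w -> perm_eq w w' -> exists f p p',
  [/\ {homo f : x y / x < y}, perm_eq p (iota 0 (size w)),
      perm_eq p' (iota 0 (size w)), w = map f p & w' = map f p'].
Proof.
move=> Uw; rewrite perm_sym => ww'.
have [f [p [fP pp ew]]] := standardize Uw.
have [Is pI ew'] := perm_iotaP 0 ww'.
have sp : size p = size w by rewrite ew size_map.
exists f, p, (map (nth 0 p) Is); split=> //.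
  by apply: perm_trans pp; apply/(perm_iotaP 0); exists Is; rewrite // sp.
rewrite ew' -map_comp; apply/eq_in_map => i; rewrite (perm_mem pI) mem_iota /= add0n => iw.
by rewrite ew (nth_map 0) // sp.
Qed.

(** Breadth-first search from the words [frontier], with at most [k] rounds. *)
Fixpoint explore k (seen frontier : seq (seq nat)) : seq (seq nat) :=
  if k is k'.+1 then
    let new := undup [seq v <- flatten (map nbrs frontier) | v \notin seen] in
    if new is [::] then seen else explore k' (new ++ seen) new
  else seen.

Lemma exploreP k w seen frontier : (forall v, v \in seen -> eqv w v) ->
  {subset frontier <= seen} -> forall v, v \in explore k seen frontier -> eqv w v.
Proof.
elim: k seen frontier => //= k IH seen frontier sP fs.
case en : (undup _) => [|v0 new]; first exact: sP.
have newP v : v \in v0 :: new -> eqv w v.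
  rewrite -en mem_undup mem_filter => /andP[_ /flattenP[l /mapP[x xf ->] /nbrsP xv]].
  exact: eqv_trans (sP x (fs _ xf)) (eqv_rot3 xv).
apply: IH => [v|v vn]; last by rewrite mem_cat vn.
by rewrite mem_cat => /orP[/newP|/sP].
Qed.

(** Words of the class of 012345, or of 012354 for the odd parity. *)
Definition big_class6 (odd_parity : bool) : seq (seq nat) :=
  let w := [:: 0; 1; 2; 3] ++ (if odd_parity then [:: 5; 4] else [:: 4; 5]) in
  explore 100 [:: w] [:: w].

(** Each permutation of six letters is small, or in the big class of its parity. *)
Lemma big_class6_check :
  let ce := big_class6 false in let co := big_class6 true in
  all (fun w => if small w then true else w \in (if inv_parity w then co else ce))
    (permutations (iota 0 6)).
Proof. by vm_compute. Qed.

(** Searches, among the words at [k] rotations or less, one whose tail is not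
    small. *)
Fixpoint escapes k (ws : seq (seq nat)) : bool :=
  if has (fun v => ~~ small (behead v)) ws then true
  else if k is k'.+1 then escapes k' (undup (flatten (map nbrs ws))) else false.

Lemma escapesP k w ws : (forall v, v \in ws -> eqv w v) -> w != [::] -> escapes k ws ->
  exists a u, eqv w (a :: u) /\ ~~ small u.
Proof.
move=> + w0; elim: k ws => [|k IH] ws wsP /=; case: ifP => //.
- case/hasP => -[|a u] /wsP wv nu _; last by exists a, u.
  by move/eqv_size: wv w0; case: (w).
- case/hasP => -[|a u] /wsP wv nu _; last by exists a, u.
  by move/eqv_size: wv w0; case: (w).
- move=> _; apply: IH => v; rewrite mem_undup => /flattenP[l /mapP[x xf ->] /nbrsP xv].
  exact: eqv_trans (wsP x xf) (eqv_rot3 xv).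
Qed.

(** The dichotomy in length 7, where the general discussion would meet the
    exceptional class of length 5; six rotations are enough. *)
Lemma escapes7_check : all (fun w => if small w then true else escapes 6 [:: w])
    (permutations (iota 0 7)).
Proof. by vm_compute. Qed.

Lemma dichotomy7 (w : seq nat) : uniq w -> size w = 7 -> small_or_escapes w.
Proof.
move=> Uw sw; have [f [p [fP pp ew]]] := standardize Uw.
rewrite sw -mem_permutations in pp; have /allP/(_ p pp) := escapes7_check.
rewrite /small_or_escapes ew small_map //; case: ifP => [|_ esc]; first by left.
right; have [||a [u [pu nu]]] := escapesP _ _ esc (w := p).
- by move=> v; rewrite inE => /eqP->; exact: Eqv_refl.
- by rewrite -size_eq0 -(size_map f) -ew sw.
by exists (f a), (map f u); rewrite small_map //; split=> //; exact: (eqv_map fP pu).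
Qed.

(** In length [n], the non-small words with given letters and given parity are
    all equivalent. *)
Definition connected n := forall w w' : seq nat, uniq w -> perm_eq w w' ->
  size w = n -> ~~ small w -> ~~ small w' -> inv_parity w = inv_parity w' -> eqv w w'.

Lemma connected6 : connected 6.
Proof.
move=> w w' Uw ww' sw.
have [f [p [p' [fP pp pp' -> ->]]]] := standardize2 Uw ww'.
rewrite !small_map // !inv_parity_map // => np np' epp'; apply: eqv_map => //.
have key q : perm_eq q (iota 0 (size w)) -> ~~ small q -> q \in big_class6 (inv_parity q).
  rewrite sw -mem_permutations => qp /negbTE nq.
  have /allP/(_ q qp) := big_class6_check.
  by rewrite nq; case: inv_parity.
have [r rP] : exists r, forall q, q \in big_class6 (inv_parity p) -> eqv r q.
  eexists => q; apply: exploreP => //.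
  by move=> v; rewrite inE => /eqP->; exact: Eqv_refl.
apply: (@eqv_trans r); first by apply/eqv_sym/rP/key.
by apply: rP; rewrite epp'; apply: key.
Qed.

Lemma parity_cons (x : nat) (u v : seq nat) : perm_eq u v ->
  (inv_parity (x :: u) == inv_parity (x :: v)) = (inv_parity u == inv_parity v).
Proof.
move=> uv /=; rewrite (seq.permP uv).
by case: (odd _); case: inv_parity; case: inv_parity.
Qed.

Lemma parity_swap (p q : seq nat) (x y : nat) : x != y ->
  inv_parity (p ++ [:: x, y & q]) = ~~ inv_parity (p ++ [:: y, x & q]).
Proof.
move=> xy; elim: p => [|z p IH] /=.
  rewrite !oddD; case: (odd (count _ q)); case: (odd (count _ q)); case: inv_parity;
  by case: ltngtP xy.
rewrite IH; have -> : count (ltn^~ z) (p ++ [:: x, y & q]) = count (ltn^~ z) (p ++ [:: y, x & q]).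
  by rewrite !count_cat /=; lia.
by rewrite addbN.
Qed.

(** A first letter [a] followed by a non-small tail can be replaced by [z]: by
    [connected] in the tail, the word becomes [a z c e ...], hence [z c a e ...];
    the letters [c], [e] and [m] beyond [z] ensure that the tails [z c e ...] and
    [c a e ...] are not small. *)
Lemma move_first d a z c e m (u : seq nat) :
  connected (size u) -> uniq (a :: u) -> 5 < size u -> ~~ small u ->
  [/\ z \in u, c \in u, e \in u & m \in u] ->
  [/\ dlt d a z, dlt d z c, dlt d c e & dlt d e m] ->
  exists u', eqv (a :: u) (z :: u') /\ ~~ small u'.
Proof.
move=> con Uau su nu [zu cu eu mu] [az zc ce em].
have Uu : uniq u by case/andP: Uau.
(* The remaining letters are put in an order r' that gives the right parity. *)
pose r := rem e (rem c (rem z u)).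
have neq x y : dlt d x y -> (y == x) = false.
  by move=> xy; apply/eqP => yx; rewrite yx dlt_irr in xy.
have zm := dlt_trans zc (dlt_trans ce em).
have pr : perm_eq u [:: z, c, e & r].
  apply: perm_trans (perm_to_rem zu) _; rewrite perm_cons.
  have cu' : c \in rem z u by rewrite mem_rem_uniq // inE cu neq.
  apply: perm_trans (perm_to_rem cu') _; rewrite perm_cons.
  apply: perm_to_rem; rewrite mem_rem_uniq ?rem_uniq // inE neq //=.
  by rewrite mem_rem_uniq // inE eu neq // (dlt_trans zc).
have mr : m \in r.
  have : m \in [:: z, c, e & r] by rewrite -(perm_mem pr).
  by rewrite !in_cons !neq // (dlt_trans ce).
have sr : 2 < size r by move/perm_size: pr su => -> /=.
have [r' [rr' par']] : exists r', perm_eq r r' /\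
    inv_parity [:: a, z, c, e & r'] = inv_parity (a :: u).
  case: (inv_parity (a :: u) =P inv_parity [:: a, z, c, e & r]) => [->|/eqP npar].
    by exists r.
  move: sr pr npar; clearbody r; case: r {mr} => [|x [|y r]] // _ pr npar.
  exists [:: y, x & r]; split; first by rewrite (perm_catCA [:: x] [:: y] r).
  have Ur := perm_uniq pr; rewrite Uu in Ur.
  have xy : y != x.
    by apply/eqP => yx; move: Ur; rewrite yx /= !in_cons eqxx !andbF.
  rewrite (@parity_swap [:: a; z; c; e] r y x) //.
  rewrite [_ ++ _]/=; move: npar.
  by case: (inv_parity (a :: u)); case: (inv_parity [:: a, _ & _]).
have mr' : m \in r' by rewrite -(perm_mem rr').
have pr' : perm_eq u [:: z, c, e & r'].
  by apply: perm_trans pr _; rewrite !perm_cons.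
have sr' : 2 < size r' by rewrite -(perm_size rr').
have szu : size u = (size r').+3 by rewrite (perm_size pr').
have n1 : ~~ small [:: z, c, e & r'].
  apply/negP => /(small_up zc); rewrite dsmall_cons; last by sizes.
  case/orP => [/andP[_ /dsmall_up]|]; first by rewrite dltN => ?; exfalso; order.
  rewrite hop_cons; last by sizes.
  case/orP => [/andP[_]|/and4P[_]]; last first.
    by rewrite ext_cons dltN => /andP[? _]; exfalso; order.
  rewrite core_cons; last by sizes.
  by case/and3P => _ /ext_mem /(_ mr'); rewrite dltN => ?; exfalso; order.
have n2 : ~~ small [:: c, a, e & r'].
  have ca : dlt (~~ d) c a by rewrite dltN (dlt_trans az).
  apply/negP => /(small_up ca) /dsmall_notmin[].
  - by sizes.
  - by rewrite !ext_cons !dltN; apply/negP => /and3P[_ ? _]; order.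
  (* Both e and m are beyond c. *)
  - move=> _; rewrite /= dltN ce => -[] /eqP; rewrite -leqn0 leqNgt -has_count => /hasPn/(_ m mr').
    by rewrite dltN (dlt_trans ce).
have ex : eqv (a :: u) [:: z, c, a, e & r'].
  apply: eqv_trans (eqv_fwd _ az zc).
  apply: eqv_cons; apply: con => //.
  by apply/eqP; rewrite -(parity_cons a pr') par'.
by exists [:: c, a, e & r'].
Qed.

(** A word of length [n + 1 >= 7] has a letter with three smaller letters and
    three larger ones; all non-small words are brought to start with it. *)
Lemma connected_step n : 5 < n ->
  (forall w : seq nat, uniq w -> size w = n.+1 -> small_or_escapes w) ->
  connected n -> connected n.+1.
Proof.
move=> n5 dich con w w' Uw ww' sw nw nw' par.
pose s := sort leq w.
have ps : perm_eq s w by rewrite perm_sort.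
have sz : size s = n.+1 by rewrite size_sort.
have ss : sorted ltn s.
  by rewrite ltn_sorted_uniq_leq sort_uniq Uw sort_sorted //; exact: leq_total.
have slt i j : i < j -> j < n.+1 -> nth 0 s i < nth 0 s j.
  move=> ij jn; apply: (sorted_ltn_nth ltn_trans) => //; rewrite inE sz //.
  exact: ltn_trans jn.
(* The index 3 leaves three letters below z, and three above as n + 1 >= 7. *)
pose z := nth 0 s 3.
have to_z v : perm_eq w v -> ~~ small v -> exists u, eqv v (z :: u) /\ ~~ small u.
  move=> wv nv; have Uv : uniq v by rewrite -(perm_uniq wv).
  have sv : size v = n.+1 by rewrite -(perm_size wv).
  have [dsmall|[a [u [vu nu]]]] := dich v Uv sv; first by rewrite dsmall in nv.
  have Uau : uniq (a :: u) by rewrite -(eqv_uniq vu).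
  have su : size u = n by move: (eqv_size vu); rewrite sv => -[].
  have mem_s x : (x \in s) = (x \in a :: u).
    by rewrite (perm_mem ps) (perm_mem wv) (perm_mem (eqv_perm vu)).
  have inu i : i < n.+1 -> nth 0 s i != a -> nth 0 s i \in u.
    move=> ni na; have : nth 0 s i \in s by rewrite mem_nth ?sz.
    by rewrite mem_s in_cons (negbTE na).
  have sle i j : i <= j -> j < n.+1 -> nth 0 s i <= nth 0 s j.
    by rewrite leq_eqVlt => /orP[/eqP->//|ij jn]; apply/ltnW/slt.
  have con_u : connected (size u) by rewrite su.
  have su5 : 5 < size u by rewrite su.
  have n7 i : i < 7 -> i < n.+1 by move=> i7; apply: leq_trans i7 _.
  have [az|az|az] := ltngtP a z; last by exists u; rewrite -az.
  - have above i : 3 <= i -> i < 7 -> nth 0 s i \in u.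
      move=> i3 /n7 i7; apply: inu => //; rewrite neq_ltn orbC.
      by rewrite (leq_trans az) // sle.
    have [||u' [uu' nu']] := @move_first true a z (nth 0 s 4) (nth 0 s 5) (nth 0 s 6)
      u con_u Uau su5 nu.
    + by split; apply: above.
    + by split=> //; apply: slt => //; exact: n7.
    by exists u'; split=> //; exact: eqv_trans vu uu'.
  - have below i : i <= 3 -> nth 0 s i \in u.
      move=> i3; apply: inu; first by apply: n7; apply: leq_ltn_trans i3 _.
      by rewrite neq_ltn (leq_ltn_trans _ az) // sle // n7.
    have [||u' [uu' nu']] := @move_first false a z (nth 0 s 2) (nth 0 s 1) (nth 0 s 0)
      u con_u Uau su5 nu.
    + by split; apply: below.
    + by split=> //; apply: slt => //; exact: n7.
    by exists u'; split=> //; exact: eqv_trans vu uu'.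
have [u [wu nu]] := to_z w (perm_refl _) nw.
have [u' [wu' nu']] := to_z w' ww' nw'.
apply: (eqv_trans wu); apply: (@eqv_trans (z :: u')); last exact: eqv_sym.
have puu' : perm_eq u u'.
  rewrite -(perm_cons z); have := eqv_perm wu; rewrite perm_sym => uw.
  exact: perm_trans uw (perm_trans ww' (eqv_perm wu')).
apply: eqv_cons; apply: con => //.
- by have := eqv_uniq wu; rewrite Uw => /esym/andP[].
- by move: (eqv_size wu); rewrite sw => -[].
- by apply/eqP; rewrite -(parity_cons z puu') -(eqv_parity wu) -(eqv_parity wu') par.
Qed.

Lemma connected_all n : 5 < n -> connected n.
Proof.
elim: n => // n IH; rewrite ltnS leq_eqVlt => /orP[/eqP<-|n5]; first exact: connected6.
apply: connected_step (IH n5) => // w Uw sw.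
have [n7|n7] := leqP n.+1 7; last by apply: dichotomy; rewrite // sw.
by apply: dichotomy7 => //; rewrite sw; apply/eqP; rewrite eqn_leq n7.
Qed.

(** * Representatives of the classes *)

(** The extreme letter, for the direction [d], of the [n + 1] letters
    [lo, ..., lo + n]. *)
Definition top (d : bool) lo n := if d then lo else lo + n.
(** The first of the letters that remain when [top d lo n] is removed. *)
Definition low (d : bool) lo := if d then lo.+1 else lo.

Lemma lowK d lo : low (~~ d) (low d lo) = lo.+1.
Proof. by case: d. Qed.

Lemma perm_top d lo n u : perm_eq u (iota (low d lo) n) ->
  perm_eq (top d lo n :: u) (iota lo n.+1).
Proof.
case: d => up; first by rewrite /= perm_cons.
by rewrite -[n.+1]addn1 iotaD perm_sym perm_catC /= perm_cons perm_sym.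
Qed.

Lemma ext_top d lo n u : perm_eq u (iota (low d lo) n) -> ext d (top d lo n) u.
Proof.
move=> up; apply/allP => x; rewrite (perm_mem up) mem_iota.
by case: d {up} => /=; lia.
Qed.

Lemma top_ext d lo n x u : perm_eq (x :: u) (iota lo n.+1) -> ext d x u ->
  x = top d lo n /\ perm_eq u (iota (low d lo) n).
Proof.
move=> xup xu; have ex : x = top d lo n.
  have tu : top d lo n \in x :: u.
    by rewrite (perm_mem xup) mem_iota /top; case: (d) => /=; lia.
  have : x \in iota lo n.+1 by rewrite -(perm_mem xup) mem_head.
  rewrite mem_iota; move: tu; rewrite in_cons => /orP[/eqP//|tu].
  by have := ext_mem xu tu; rewrite /top; case: (d) => /=; lia.
split=> //; rewrite -(perm_cons x) {2}ex; apply: perm_trans xup _.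
by rewrite perm_sym perm_top.
Qed.

(** The [n] letters from [lo] on, sorted in direction [d]. *)
Fixpoint ramp d lo n : seq nat :=
  if n is m.+1 then top d lo m :: ramp d (low d lo) m else [::].

(** The alternation smallest, largest, second smallest, ... (if [d] is [true]) of
    the [n] letters from [lo] on. *)
Fixpoint zigzag d lo n : seq nat :=
  if n is m.+1 then top d lo m :: zigzag (~~ d) (low d lo) m else [::].

(** For odd [n >= 3], the same alternation, ending with three sorted letters. *)
Fixpoint zigramp d lo n : seq nat :=
  if n == 3 then ramp d lo 3
  else if n is m.+1 then top d lo m :: zigramp (~~ d) (low d lo) m else [::].

Lemma zigzagS d lo m : zigzag d lo m.+1 = top d lo m :: zigzag (~~ d) (low d lo) m.
Proof. by []. Qed.

Lemma zigrampS d lo m : m != 2 ->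
  zigramp d lo m.+1 = top d lo m :: zigramp (~~ d) (low d lo) m.
Proof. by case: m => [|[|[|m]]]. Qed.

Lemma ramp_perm d lo n : perm_eq (ramp d lo n) (iota lo n).
Proof. by elim: n lo => // n IH lo; apply: perm_top. Qed.

Lemma zigzag_perm d lo n : perm_eq (zigzag d lo n) (iota lo n).
Proof. by elim: n d lo => // n IH d lo; apply: perm_top. Qed.

Lemma zigramp_perm d lo n : perm_eq (zigramp d lo n) (iota lo n).
Proof.
elim: n d lo => // n IH d lo; rewrite [zigramp _ _ _]/=.
by case: eqP => [->|_]; [exact: (ramp_perm d lo 3) | apply: perm_top].
Qed.

Lemma dsorted_ramp d lo n w : dsorted d w -> perm_eq w (iota lo n) -> w = ramp d lo n.
Proof.
elim: n lo w => [|n IH] lo w; first by move=> _ /perm_nilP.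
case: w => [|x u] cw wp; first by have := perm_size wp; rewrite size_iota.
have xu : ext d x u by apply: order_path_min cw; exact: dlt_trans.
have [-> up] := top_ext wp xu.
by rewrite /= -(IH _ u) //; move: cw; apply: path_sorted.
Qed.

Lemma zigzag_core d lo n : core d (zigzag d lo n).
Proof.
have [k] := ubnP n; elim: k n lo => // k IH [|[|n]] // lo nk.
rewrite [zigzag _ _ _]/=; rewrite negbK; apply: core_front.
- have := ext_top (zigzag_perm (~~ d) (low d lo) n.+1); rewrite [zigzag _ _ _]/= negbK; exact.
- exact/ext_top/zigzag_perm.
- by apply: IH; lia.
Qed.

Lemma ramp_dsorted d lo n : dsorted d (ramp d lo n).
Proof.
elim: n lo => // n IH lo; rewrite /dsorted [ramp _ _ _]/=.
move: (IH (low d lo)) (ext_top (ramp_perm d (low d lo) n)).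
by case: (ramp _ _ _) => // y u cu; rewrite ext_cons => /andP[ty _]; apply/andP.
Qed.

Lemma zigramp_core d lo n : odd n -> 2 < n -> core d (zigramp d lo n).
Proof.
have [k] := ubnP n; elim: k n lo => // k IH [|[|[|[|[|n]]]]] // lo nk on _.
  by apply/or3P/Or31; exact: (ramp_dsorted d lo 3).
have e : zigramp d lo n.+3.+2 = [:: top d lo n.+4, top (~~ d) (low d lo) n.+3
  & zigramp d lo.+1 n.+3] by rewrite (@zigrampS _ _ n.+4) // (@zigrampS _ _ n.+3) // negbK lowK.
rewrite e; apply: core_front.
- have := ext_top (zigramp_perm (~~ d) (low d lo) n.+4).
  by rewrite (@zigrampS _ _ n.+3) // negbK lowK.
- by apply: ext_top; rewrite lowK; exact: zigramp_perm.
- by apply: IH; move: on nk => /=; lia.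
Qed.

(** Up to equivalence, [core d] contains at most two words on given letters. *)
Lemma core_canon d lo n z : core d z -> perm_eq z (iota lo n) ->
  eqv z (zigzag d lo n) \/ [/\ odd n, 2 < n & eqv z (zigramp d lo n)].
Proof.
have [k] := ubnP n; elim: k n lo z => // k IH n lo z nk cz zp.
have sz : size z = n by rewrite (perm_size zp) size_iota.
(* Peeling off the first two letters, which are determined. *)
have split2 m x y v : n = m.+2 -> z = [:: x, y & v] -> ext d x (y :: v) ->
    ext (~~ d) y v -> core d v ->
    eqv z (zigzag d lo n) \/ [/\ odd n, 2 < n & eqv z (zigramp d lo n)].
  move=> en ez xyv yv cv; rewrite en ez in zp *.
  have [-> yvp] := top_ext zp xyv; have [-> vp] := top_ext yvp yv.
  have mk : m < k by move: nk; rewrite en; lia.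
  case: (IH m _ v mk cv vp) => [vz|[om m3 vz]]; [left|right].
    by rewrite [zigzag _ _ _]/= negbK; do 2!apply: eqv_cons.
  split; [by rewrite /= negbK | by apply: leq_trans m3 _; rewrite -addn2 leq_addr |].
  rewrite (@zigrampS _ _ m.+1) ?(@zigrampS _ _ m) ?negbK; first by do 2!apply: eqv_cons.
    by apply: contraTneq m3 => ->.
  by apply: contraTneq m3 => -[->].
case: z cz zp sz split2 => [|x [|y v]] cz zp sz split2.
- by left; rewrite -sz; exact: Eqv_refl.
- left; rewrite -sz in zp *; have [-> _] := @top_ext d lo 0 x [::] zp isT.
  exact: Eqv_refl.
case: v cz zp sz split2 => [|t [|t' v]] cz zp sz split2.
- by apply: (split2 0 x y [::]) => //; rewrite ext_cons (core_up cz).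
- case/or3P: (cz) => cc.
  + by right; rewrite -sz in zp *; rewrite (dsorted_ramp cc zp) /=; split=> //; exact: Eqv_refl.
  + right; rewrite -sz in zp *; split=> //; rewrite [zigramp _ _ _]/=.
    have pt : perm_eq [:: t; x; y] (iota lo 3).
      by apply: perm_trans zp; rewrite (perm_catC [:: t] [:: x; y]).
    rewrite -/(ramp d lo 3) -(dsorted_ramp cc pt).
    by case/and3P: cc => tx xy _; exact: (eqv_bwd _ tx xy).
  + case/and3P: cc => xt ty _; apply: (split2 1 x y [:: t]) => //.
      by rewrite !ext_cons xt (dlt_trans xt).
    by rewrite ext_cons dltN ty.
- move: cz; rewrite core_cons // => /and3P[? ? ?].
  by apply: (split2 (size v).+2 x y [:: t, t' & v]).
Qed.

(** The word 13245 of the exceptional class, on the letters [lo, ..., lo + 4]. *)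
Definition rep5 d lo : seq nat :=
  if ramp d lo 5 is [:: a; b; c; e; f] then [:: a; c; b; e; f] else [::].

(** Representatives, on [m + 1] letters, of the small classes whose first letter
    is not fixed: at most two of them, of opposite parities. *)
Definition hop_reps d lo m : seq (seq nat) :=
  (if 1 < m then [:: top d lo m :: zigzag d (low d lo) m] else [::]) ++
  (if odd m && (2 < m) then [:: top d lo m :: zigramp d (low d lo) m] else [::]) ++
  (if m == 4 then [:: rep5 d lo] else [::]).

(** Representatives of the small classes of direction [d] on the [n] letters from
    [lo] on. *)
Fixpoint reps d lo n : seq (seq nat) :=
  match n with
  | 0 => [::]
  | 1 => [:: [:: lo]]
  | m.+1 => map (cons (top d lo m)) (reps (~~ d) (low d lo) m) ++ hop_reps d lo m
  end.

Lemma repsS d lo m : reps d lo m.+2 =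
  map (cons (top d lo m.+1)) (reps (~~ d) (low d lo) m.+1) ++ hop_reps d lo m.+1.
Proof. by []. Qed.

Lemma size_reps d lo n : 4 < n -> size (reps d lo n) = n + n./2 - 1.
Proof.
elim: n d lo => // n IH d lo; rewrite ltnS leq_eqVlt => /orP[/eqP<-|n4]; first by [].
case: n IH n4 => // n IH n4; rewrite repsS size_cat size_map IH // /hop_reps !size_cat.
have -> : 1 < n.+1 by lia.
have -> : 2 < n.+1 by lia.
have -> : (n.+1 == 4) = false by lia.
by rewrite andbT; case: ifP => /=; lia.
Qed.

(** For sorted letters 1, ..., 5, the seven words of the exceptional class. *)
Lemma eqv_rep5 d (a b c e f : nat) : dsorted d [:: a; b; c; e; f] ->
  {in [:: [:: a; c; b; e; f]; [:: a; e; c; b; f]; [:: a; c; e; f; b]; [:: c; e; a; f; b];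
   [:: a; e; f; c; b]; [:: e; f; a; c; b]; [:: c; f; e; a; b]],
   forall w, eqv w [:: a; c; b; e; f]}.
Proof.
rewrite /dsorted /= andbT => /and4P[ab bc ce ef] w.
have w2 : eqv [:: a; e; c; b; f] [:: a; c; b; e; f].
  by apply: eqv_cons; apply: (@eqv_fwd (~~ d)); order.
have w3 : eqv [:: a; c; e; f; b] [:: a; c; b; e; f].
  by do 2!apply: eqv_cons; apply: (@eqv_bwd d); order.
have w4 : eqv [:: c; e; a; f; b] [:: a; c; b; e; f].
  by apply: eqv_trans w3; apply: (@eqv_bwd d); order.
have w5 : eqv [:: a; e; f; c; b] [:: a; c; b; e; f].
  by apply: eqv_trans w2; do 2!apply: eqv_cons; apply: (@eqv_fwd (~~ d)); order.
rewrite !inE; case/or4P => [/eqP->|/eqP->|/eqP->|/or4P[] /eqP->] //.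
- exact: Eqv_refl.
- by apply: eqv_trans w5; apply: (@eqv_bwd d); order.
- by apply: eqv_trans w4; apply: eqv_cons; apply: (@eqv_fwd (~~ d)); order.
Qed.

Lemma rep5E d lo a b c e f : ramp d lo 5 = [:: a; b; c; e; f] ->
  rep5 d lo = [:: a; c; b; e; f].
Proof. by rewrite /rep5 => ->. Qed.

Lemma hop5_rep d lo w : hop5 d w -> perm_eq w (iota lo 5) -> eqv w (rep5 d lo).
Proof.
case: w => [|a [|b [|c [|e [|f [|? ?]]]]]] // sw wp.
have key s : dsorted d s -> perm_eq s [:: a; b; c; e; f] -> s = ramp d lo 5.
  by move=> cs sp; apply: dsorted_ramp cs (perm_trans sp wp).
move: sw; rewrite /hop5 /= => /orP[|/orP[|/orP[|/orP[|/orP[|/orP[|/orP[|//]]]]]]] cs;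
  rewrite (rep5E (esym (key _ cs _))) //;
  first [by apply: (eqv_rep5 cs); rewrite !inE eqxx ?orbT
        |by apply/seq.permP => P /=; clear; lia].
Qed.

Lemma rep5_perm d lo : perm_eq (rep5 d lo) (iota lo 5).
Proof.
apply: perm_trans (ramp_perm d lo 5); apply/seq.permP => P /=; clear; lia.
Qed.

Lemma rep5_dsmall d lo : dsmall d (rep5 d lo).
Proof.
have := ramp_dsorted d lo 5; case er : (ramp d lo 5) => [|a [|b [|c [|e [|f [|? ?]]]]]] // cs.
by rewrite (rep5E er) dsmallE; apply/or3P/Or33; rewrite /= cs.
Qed.

Lemma hop_reps_perm d lo m r : r \in hop_reps d lo m -> perm_eq r (iota lo m.+1).
Proof.
rewrite /hop_reps !mem_cat; case/or3P; case: ifP => // cm; rewrite inE => /eqP->.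
- exact/perm_top/zigzag_perm.
- exact/perm_top/zigramp_perm.
- by rewrite (eqP cm); exact: rep5_perm.
Qed.

Lemma reps_perm d lo n r : r \in reps d lo n -> perm_eq r (iota lo n).
Proof.
elim: n d lo r => // -[_|m IH] d lo r; first by rewrite inE => /eqP->.
rewrite repsS mem_cat => /orP[/mapP[s /IH sp ->]|/hop_reps_perm //].
exact: perm_top.
Qed.

Lemma hop_reps_dsmall d lo m r : r \in hop_reps d lo m -> dsmall d r.
Proof.
rewrite /hop_reps !mem_cat; case/or3P; case: ifP => // cm; rewrite inE => /eqP->.
- by apply/hop_dsmall/hop_front; [exact/ext_top/zigzag_perm | exact: zigzag_core].
- apply/hop_dsmall/hop_front; first exact/ext_top/zigramp_perm.
  by case/andP: cm => *; apply: zigramp_core.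
- exact: rep5_dsmall.
Qed.

Lemma reps_dsmall d lo n r : r \in reps d lo n -> dsmall d r.
Proof.
elim: n d lo r => // -[_|m IH] d lo r; first by rewrite inE => /eqP->.
rewrite repsS mem_cat => /orP[/mapP[s sr ->]|/hop_reps_dsmall //].
by apply: dsmall_front (IH _ _ _ sr); exact/ext_top/(reps_perm sr).
Qed.

Lemma reps_cover d lo n w : dsmall d w -> perm_eq w (iota lo n) ->
  exists2 r, r \in reps d lo n & eqv w r.
Proof.
elim: n d lo w => [|n IH] d lo w sw wp; first by move/perm_nilP: wp sw => ->.
case: n IH wp => [|m] IH wp.
  move: (wp) => /perm_small_eq -> //.
  by exists [:: lo]; rewrite ?mem_head //; exact: Eqv_refl.
have Uw : uniq w by rewrite (perm_uniq wp) iota_uniq.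
have via h u : eqv w (h :: u) -> ext d h u ->
  h = top d lo m.+1 /\ perm_eq u (iota (low d lo) m.+1).
  move=> whu hu; apply: top_ext hu; apply: perm_trans wp.
  by rewrite perm_sym; exact: eqv_perm.
case: w sw wp Uw via => [|x [|y u]] sw wp Uw via; try by move: (perm_size wp).
move: sw; rewrite dsmallE => /or3P[/andP[xu su]|hw|s5].
- have [|ex up] := via x (y :: u) _ xu; first exact: Eqv_refl.
  have [r rr ur] := IH _ _ _ su up; exists (x :: r); last exact: eqv_cons.
  by rewrite repsS mem_cat ex map_f.
- have [h [z [whz hz cz]]] := hop_rep Uw hw.
  have [eh zp] := via _ _ whz hz.
  case: (core_canon cz zp) => [zz|[om m3 zz]].
    (* For two letters, the hopping word also has a fixed first letter and is
       already counted among the words of the first kind. *)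
    exists (h :: zigzag d (low d lo) m.+1); last first.
      by apply: eqv_trans whz _; exact: eqv_cons.
    rewrite repsS mem_cat eh; case: m {IH wp via zp eh zz} => [|m].
      by rewrite map_f // inE; case: (d) => /=; rewrite ?addn0.
    by rewrite /hop_reps mem_cat mem_head orbT.
  exists (h :: zigramp d (low d lo) m.+1); last first.
    by apply: eqv_trans whz _; exact: eqv_cons.
  by rewrite repsS mem_cat eh /hop_reps !mem_cat om m3 mem_head !orbT.
- have em : m = 3.
    move: s5 (perm_size wp); rewrite size_iota.
    by case: u {wp Uw via} => [|? [|? [|? [|? ?]]]] //= _ [].
  rewrite em in wp *; exists (rep5 d lo); last exact: hop5_rep.
  by rewrite repsS mem_cat /hop_reps !mem_cat mem_head !orbT.
Qed.

(** * The representatives are pairwise inequivalent *)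

Lemma hop_moves d h z : ext d h z -> core d z -> 1 < size z ->
  exists y u, eqv (h :: z) (y :: u) /\ y != h.
Proof.
case: z => [|x [|y v]] // hz cz _; have xy := core_up cz.
have hx : dlt d h x by move: hz; rewrite ext_cons => /andP[].
exists x, [:: y, h & v]; split; first exact: (@eqv_fwd d).
by apply/eqP => xh; rewrite xh dlt_irr in hx.
Qed.

(** In the classes of [hop_reps], the first letter does move; this separates them
    from the classes with a fixed first letter. *)
Lemma hop_reps_move d lo m e : e \in hop_reps d lo m ->
  exists y u, eqv e (y :: u) /\ y != top d lo m.
Proof.
rewrite /hop_reps !mem_cat; case/or3P; case: ifP => // cm; rewrite inE => /eqP->.
- apply: hop_moves; first exact/ext_top/zigzag_perm.
    exact: zigzag_core.
  by rewrite (perm_size (zigzag_perm _ _ _)) size_iota.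
- case/andP: cm => om m2; apply: hop_moves; first exact/ext_top/zigramp_perm.
    exact: zigramp_core.
  by rewrite (perm_size (zigramp_perm _ _ _)) size_iota ltnW.
- have := ramp_dsorted d lo 5; case er : (ramp d lo 5) => [|a [|b [|c [|e' [|f [|? ?]]]]]] // cs.
  rewrite (rep5E er); exists c, [:: e'; a; f; b]; split.
    by apply/eqv_sym/(eqv_rep5 cs); rewrite !inE eqxx ?orbT.
  have -> : top d lo m = a by rewrite (eqP cm); case: er.
  move: cs; rewrite /dsorted /= => /and3P[ab bc _].
  by apply/eqP => ca; rewrite ca in bc; order.
Qed.

Lemma zigzag_zigramp_parity d lo m : odd m -> 2 < m ->
  inv_parity (zigzag d lo m) != inv_parity (zigramp d lo m).
Proof.
have [k] := ubnP m; elim: k m lo => // k IH [|[|[|[|[|m]]]]] // lo mk om _.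
  have shift p q : zigzag d lo 3 = map (addn lo) p -> zigramp d lo 3 = map (addn lo) q ->
      inv_parity p != inv_parity q -> inv_parity (zigzag d lo 3) != inv_parity (zigramp d lo 3).
    have hl : {homo addn lo : x y / x < y} by move=> x y; rewrite ltn_add2l.
    by move=> -> ->; rewrite !inv_parity_map.
  case: (d) in shift *.
    by apply: (shift [:: 0; 2; 1] [:: 0; 1; 2]) => //=; congr [:: _; _; _]; lia.
  by apply: (shift [:: 2; 0; 1] [:: 2; 1; 0]) => //=; congr [:: _; _; _]; lia.
rewrite 2!zigzagS (@zigrampS _ _ m.+4) // (@zigrampS _ _ m.+3) // !negbK !lowK.
have pz : perm_eq (zigzag d lo.+1 m.+3) (zigramp d lo.+1 m.+3).
  by apply: perm_trans (zigzag_perm _ _ _) _; rewrite perm_sym zigramp_perm.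
rewrite parity_cons ?perm_cons // parity_cons //.
by apply: IH; move: om mk => /=; lia.
Qed.

Lemma zigzag_rep5_parity d lo :
  inv_parity (top d lo 4 :: zigzag d (low d lo) 4) != inv_parity (rep5 d lo).
Proof.
have hl : {homo addn lo : x y / x < y} by move=> x y; rewrite ltn_add2l.
case: d.
  have -> : top true lo 4 :: zigzag true (low true lo) 4 = map (addn lo) [:: 0; 1; 4; 2; 3].
    by rewrite /=; congr [:: _; _; _; _; _]; lia.
  have -> : rep5 true lo = map (addn lo) [:: 0; 2; 1; 3; 4].
    by rewrite /rep5 /=; congr [:: _; _; _; _; _]; lia.
  by rewrite !inv_parity_map.
have -> : top false lo 4 :: zigzag false (low false lo) 4 = map (addn lo) [:: 4; 3; 0; 2; 1].
  by rewrite /=; congr [:: _; _; _; _; _]; lia.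
have -> : rep5 false lo = map (addn lo) [:: 4; 2; 3; 1; 0].
  by rewrite /rep5 /=; congr [:: _; _; _; _; _]; lia.
by rewrite !inv_parity_map.
Qed.

Lemma hop_reps_parity d lo m : uniq (map inv_parity (hop_reps d lo m)).
Proof.
rewrite /hop_reps; case: ifP => m1; case: ifP => m2; case: ifP => m4 //=; last by lia.
- by move: m2; rewrite (eqP m4).
- case/andP: m2 => om m2; rewrite -/(inv_parity (_ :: _)) andbT inE.
  have := zigzag_zigramp_parity d (low d lo) om m2.
  rewrite -(parity_cons (top d lo m)) //.
  by apply: perm_trans (zigzag_perm _ _ _) _; rewrite perm_sym zigramp_perm.
- rewrite andbT inE -/(inv_parity (_ :: _)) (eqP m4); exact: zigzag_rep5_parity.
Qed.

Lemma uniq_map_inj (T1 T2 : eqType) (f : T1 -> T2) (s : seq T1) :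
  uniq (map f s) -> {in s &, injective f}.
Proof.
elim: s => //= x s IH /andP[nx us] y z; rewrite !inE.
case/orP => [/eqP->|ys]; case/orP => [/eqP->|zs] // e; last exact: IH.
  by rewrite e map_f in nx.
by rewrite -e map_f in nx.
Qed.

Lemma reps_uniq_inj d lo n : uniq (reps d lo n) /\
  {in reps d lo n &, forall r r', eqv r r' -> r = r'}.
Proof.
elim: n d lo => // -[_|m IH] d lo; first by split=> // r r'; rewrite !inE => /eqP-> /eqP->.
have [Us inj] := IH (~~ d) (low d lo).
have tail s w : s \in reps (~~ d) (low d lo) m.+1 -> eqv (top d lo m.+1 :: s) w ->
    exists2 v, w = top d lo m.+1 :: v & eqv s v.
  move=> sr; have sp := reps_perm sr; apply: eqv_min_tail (ext_top sp) (reps_dsmall sr).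
  by rewrite (perm_uniq (perm_top sp)) iota_uniq.
have apart s e : s \in reps (~~ d) (low d lo) m.+1 -> e \in hop_reps d lo m.+1 ->
    eqv (top d lo m.+1 :: s) e -> False.
  move=> sr /hop_reps_move[y [u [eyu ny]]] se.
  by have [v [ey _] _] := tail s _ sr (eqv_trans se eyu); rewrite ey eqxx in ny.
rewrite repsS; split.
  rewrite cat_uniq map_inj_uniq ?Us; last by move=> x y [].
  rewrite (map_uniq (hop_reps_parity d lo m.+1)) andbT; apply/hasPn => e er.
  apply/mapP => -[s sr es]; apply: (apart s e) => //; rewrite es; exact: Eqv_refl.
move=> r r'; rewrite [r \in _]mem_cat [r' \in _]mem_cat.
case/orP => [/mapP[s sr ->]|er]; case/orP => [/mapP[s' sr' ->]|er'] rr'.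
- by have [v [<-] ss'] := tail _ _ sr rr'; rewrite (inj _ _ sr sr' ss').
- by case: (apart _ _ sr er' rr').
- by case: (apart _ _ sr' er (eqv_sym rr')).
- exact: (uniq_map_inj (hop_reps_parity d lo m.+1)) (eqv_parity rr').
Qed.

Lemma small_increasing (x y z m : nat) (u : seq nat) :
  x < y -> y < z -> z < m -> m \in u -> 2 < size u -> ~~ small [:: x, y, z & u].
Proof.
move=> xy yz zm mu su; apply/negP => /(@small_up true _ _ _ xy); rewrite dsmall_cons; last by sizes.
case/orP => [/andP[_ /dsmall_up]|]; first by rewrite /=; lia.
rewrite hop_cons; last by sizes.
case/orP => [/andP[_]|/and4P[_]]; last by rewrite ext_cons /= => /andP[? _]; lia.
rewrite core_cons; last by sizes.
by case/and3P => _ /ext_mem /(_ mu) /=; lia.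
Qed.

(** Representatives of all classes: the small ones in both directions, and one big
    class for each parity. *)
Definition all_reps n : seq (seq nat) :=
  reps true 1 n ++ reps false 1 n ++
  [:: iota 1 n.-2 ++ [:: n.-1; n]; iota 1 n.-2 ++ [:: n; n.-1]].

Section AllReps.
Variables (n : nat) (hn : 5 < n).

Let big := [:: iota 1 n.-2 ++ [:: n.-1; n]; iota 1 n.-2 ++ [:: n; n.-1]].

Lemma big_perm b : b \in big -> perm_eq b (iota 1 n).
Proof.
have en : n = n.-2 + 2 by move: hn; case: n => [|[|m]] //=; lia.
have e : iota 1 n = iota 1 n.-2 ++ [:: n.-1; n].
  rewrite {1}en iotaD /=; congr (_ ++ [:: _; _]); move: en; lia.
rewrite e !inE => /orP[] /eqP->; first exact: perm_refl.
by rewrite perm_cat2l (perm_catC [:: n] [:: n.-1]).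
Qed.

Lemma big_small b : b \in big -> ~~ small b.
Proof.
move=> bb; have : n \in b by rewrite (perm_mem (big_perm bb)) mem_iota; move: hn; lia.
have : size b = n by rewrite (perm_size (big_perm bb)) size_iota.
move: bb hn; rewrite !inE; case: (n) => [|[|[|[|[|m]]]]] // /orP[] /eqP-> m5 sb nb;
  by apply: (@small_increasing _ _ _ m.+1.+4) => //; case: sb => ->; move: m5; lia.
Qed.

Lemma big_parity : inv_parity (iota 1 n.-2 ++ [:: n.-1; n]) =
  ~~ inv_parity (iota 1 n.-2 ++ [:: n; n.-1]).
Proof. by apply: parity_swap; move: hn; lia. Qed.

Lemma all_reps_perm r : r \in all_reps n -> perm_eq r (iota 1 n).
Proof. by rewrite !mem_cat => /or3P[/reps_perm|/reps_perm|/big_perm]. Qed.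

Lemma all_reps_cover w : perm_eq w (iota 1 n) -> exists2 r, r \in all_reps n & eqv w r.
Proof.
move=> wp; have [/orP[sw|sw]|nw] := boolP (small w).
- by have [r rr wr] := reps_cover sw wp; exists r; rewrite // mem_cat rr.
- by have [r rr wr] := reps_cover sw wp; exists r; rewrite // !mem_cat rr orbT.
have Uw : uniq w by rewrite (perm_uniq wp) iota_uniq.
have sw : size w = n by rewrite (perm_size wp) size_iota.
have key b : b \in big -> inv_parity w = inv_parity b -> eqv w b.
  move=> bb; apply: (connected_all hn) => //; last exact: big_small.
  by apply: perm_trans wp _; rewrite perm_sym big_perm.
have [b bb wb] : exists2 b, b \in big & inv_parity w = inv_parity b.
  have := big_parity; case: (inv_parity w); case e : (inv_parity (_ ++ [:: n; _])) => e'.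
  - by exists (iota 1 n.-2 ++ [:: n; n.-1]); rewrite ?e // !inE eqxx orbT.
  - by exists (iota 1 n.-2 ++ [:: n.-1; n]); rewrite ?e' // mem_head.
  - by exists (iota 1 n.-2 ++ [:: n.-1; n]); rewrite ?e' // mem_head.
  - by exists (iota 1 n.-2 ++ [:: n; n.-1]); rewrite ?e // !inE eqxx orbT.
by exists b; [rewrite !mem_cat bb !orbT | exact: key].
Qed.

Lemma all_reps_uniq_inj : uniq (all_reps n) /\
  {in all_reps n &, forall r r', eqv r r' -> r = r'}.
Proof.
have U r : r \in all_reps n -> uniq r.
  by move/all_reps_perm/perm_uniq => ->; exact: iota_uniq.
have sz r : r \in all_reps n -> 1 < size r.
  by move/all_reps_perm/perm_size => ->; rewrite size_iota; move: hn; lia.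
have [U1 I1] := reps_uniq_inj true 1 n; have [U2 I2] := reps_uniq_inj false 1 n.
have in1 r : r \in reps true 1 n -> r \in all_reps n by move=> rr; rewrite mem_cat rr.
have in2 r : r \in reps false 1 n -> r \in all_reps n by move=> rr; rewrite !mem_cat rr orbT.
have in3 r : r \in big -> r \in all_reps n by move=> rr; rewrite !mem_cat rr !orbT.
have D12 r r' : r \in reps true 1 n -> r' \in reps false 1 n -> ~ eqv r r'.
  move=> rr rr' e; have := dsmall_eqv (U _ (in1 _ rr)) e (reps_dsmall rr).
  have := reps_dsmall rr'; have := sz _ (in2 _ rr'); case: (r') => [|x [|y u]] // _.
  by move=> /dsmall_up + /dsmall_up; rewrite /=; lia.
have Dbig r b : small r -> r \in all_reps n -> b \in big -> ~ eqv r b.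
  move=> sr rr bb e; have := small_eqv (U _ rr) e sr.
  by rewrite (negbTE (big_small bb)).
have D13 r b : r \in reps true 1 n -> b \in big -> ~ eqv r b.
  by move=> rr; apply: Dbig (in1 _ rr); apply/dsmall_small/(reps_dsmall rr).
have D23 r b : r \in reps false 1 n -> b \in big -> ~ eqv r b.
  by move=> rr; apply: Dbig (in2 _ rr); apply/dsmall_small/(reps_dsmall rr).
have par := big_parity.
have I3 : {in big &, forall r r', eqv r r' -> r = r'}.
  move=> r r'; rewrite !inE => /orP[] /eqP-> /orP[] /eqP-> // /eqv_parity;
  by rewrite par; case: inv_parity.
split.
  rewrite cat_uniq U1 has_cat negb_or; apply/and3P; split=> //.
    apply/andP; split; apply/hasPn => r rr; apply/negP => rr'.
      by case: (D12 _ _ rr' rr); exact: Eqv_refl.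
    by case: (D13 _ _ rr' rr); exact: Eqv_refl.
  rewrite cat_uniq U2; apply/and3P; split=> //.
    by apply/hasPn => r rr; apply/negP => rr'; case: (D23 _ _ rr' rr); exact: Eqv_refl.
  by rewrite /= inE andbT; apply/eqP => e; move: par; rewrite e; case: inv_parity.
move=> r r'; rewrite !mem_cat -/big => /or3P[] rr /or3P[] rr' e.
- exact: I1.
- by case: (D12 _ _ rr rr' e).
- by case: (D13 _ _ rr rr' e).
- by case: (D12 _ _ rr' rr (eqv_sym e)).
- exact: I2.
- by case: (D23 _ _ rr rr' e).
- by case: (D13 _ _ rr' rr (eqv_sym e)).
- by case: (D23 _ _ rr' rr (eqv_sym e)).
- exact: I3.
Qed.

Lemma size_all_reps : size (all_reps n) = 2 * (n + n./2).
Proof. by rewrite !size_cat !size_reps ?(ltnW hn) //=; move: hn; lia. Qed.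

End AllReps.

(** * Words and permutations *)

Lemma oneline_perm n (s : 'S_n) : perm_eq (oneline s) (iota 1 n).
Proof.
apply: uniq_perm; rewrite ?iota_uniq //.
  by rewrite map_inj_uniq ?enum_uniq // => i j [/val_inj/perm_inj].
move=> x; rewrite mem_iota add1n ltnS; apply/mapP/andP => [[i _ ->]|[x0 xn]].
  by split=> //; exact: ltn_ord.
have xn' : x.-1 < n by rewrite prednK.
exists ((s^-1)%g (Ordinal xn')); first by rewrite mem_enum.
by rewrite permKV /= prednK.
Qed.

Lemma oneline_surj n (w : seq nat) : perm_eq w (iota 1 n) -> exists s : 'S_n, oneline s = w.
Proof.
move=> wp; have sw : size w = n by rewrite (perm_size wp) size_iota.
have wi (i : 'I_n) : 0 < nth 0 w i <= n.
  have : nth 0 w i \in w by rewrite mem_nth // sw.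
  by rewrite (perm_mem wp) mem_iota add1n ltnS.
have fP (i : 'I_n) : (nth 0 w i).-1 < n by case/andP: (wi i) => w0; rewrite prednK.
have finj : injective (fun i => Ordinal (fP i)).
  move=> i j [e]; apply/val_inj/eqP.
  have Uw : uniq w by rewrite (perm_uniq wp) iota_uniq.
  rewrite -(nth_uniq 0 _ _ Uw) ?sw; try exact: ltn_ord.
  by case/andP: (wi i) (wi j) => i0 _ /andP[j0 _]; rewrite -(prednK i0) -(prednK j0) e.
exists (perm finj); apply: (@eq_from_nth _ 0); rewrite size_oneline // => i ni.
rewrite (nth_oneline _ (Ordinal ni)) permE /=.
by case/andP: (wi (Ordinal ni)) => i0 _; rewrite prednK.
Qed.

(** A rotation, in either sense, in the form of concatenations with common ends. *)
Lemma rot3P u v : rot3 u v -> exists a b d x y z, [/\ dlt d x y, dlt d y z &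
  (u = a ++ [:: x; y; z] ++ b /\ v = a ++ [:: y; z; x] ++ b) \/
  (v = a ++ [:: x; y; z] ++ b /\ u = a ++ [:: y; z; x] ++ b)].
Proof.
elim=> [d x y z t xy yz|d x y z t xy yz|x u' v' _ [a [b [d [x' [y [z [xy yz H]]]]]]]].
- by exists [::], t, d, x, y, z; split=> //; left.
- by exists [::], t, d, x, y, z; split=> //; right.
- exists (x :: a), b, d, x', y, z; split=> //.
  by case: H => -[-> ->]; [left | right].
Qed.

Lemma rot3_cat a u v b : rot3 u v -> rot3 (a ++ u ++ b) (a ++ v ++ b).
Proof.
move=> uv; elim: a => [|x a IH] /=; last exact: Rot_cons.
elim: uv => [d x y z t xy yz|d x y z t xy yz|x u' v' _ IH] /=; last exact: Rot_cons.
  exact: Rot_fwd xy yz.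
exact: Rot_bwd xy yz.
Qed.

Lemma eqv_cat a u v b : eqv u v -> eqv (a ++ u ++ b) (a ++ v ++ b).
Proof.
elim=> [w|v' u' w /(rot3_cat a b) uv _]; first exact: Eqv_refl.
exact: Eqv_step.
Qed.

(** The part {123, 231} for [d = true], and {321, 213} for [d = false]. *)
Definition block d : {set 'S_3} :=
  if d then of_onelines 3 [:: [:: 1; 2; 3]; [:: 2; 3; 1]]
  else of_onelines 3 [:: [:: 3; 2; 1]; [:: 2; 1; 3]].

(** The six comparisons encoded by the order permutation of a word of length 3. *)
Lemma order_permP (x y z : nat) (s : 'S_3) : is_order_perm [:: x; y; z] s ->
  [/\ (nth 0 (oneline s) 0 < nth 0 (oneline s) 1) = (x < y),
      (nth 0 (oneline s) 1 < nth 0 (oneline s) 2) = (y < z),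
      (nth 0 (oneline s) 0 < nth 0 (oneline s) 2) = (x < z),
      (nth 0 (oneline s) 1 < nth 0 (oneline s) 0) = (y < x) &
      (nth 0 (oneline s) 2 < nth 0 (oneline s) 1) = (z < y) /\
      (nth 0 (oneline s) 2 < nth 0 (oneline s) 0) = (z < x)].
Proof.
case/andP => _ /forallP H.
have K i j (i3 : i < 3) (j3 : j < 3) : (nth 0 (oneline s) i < nth 0 (oneline s) j) =
    (nth 0 [:: x; y; z] i < nth 0 [:: x; y; z] j).
  rewrite (nth_oneline s (Ordinal i3)) (nth_oneline s (Ordinal j3)) ltnS.
  by have /forallP/(_ (Ordinal j3))/eqP := H (Ordinal i3).
by split; [exact: (K 0 1) | exact: (K 1 2) | exact: (K 0 2) | exact: (K 1 0) |
  split; [exact: (K 2 1) | exact: (K 2 0)]].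
Qed.

(** A word whose order permutation lies in a part with two elements is monotone
    up to one rotation. *)
Lemma block_dsorted d (x y z : nat) (s : 'S_3) : is_order_perm [:: x; y; z] s -> s \in block d ->
  exists2 w, dsorted d w & eqv [:: x; y; z] w.
Proof.
move=> /order_permP; case: d; rewrite inE !inE => + /orP[] /eqP es; rewrite es /=.
- case=> xy yz *; exists [:: x; y; z]; last exact: Eqv_refl.
  by rewrite /dsorted /= -xy -yz.
- case=> xy _ _ _ [_ zx]; exists [:: z; x; y]; first by rewrite /dsorted /= -xy -zx.
  by apply: (@eqv_bwd true); rewrite /= -?xy -?zx.
- case=> _ _ _ yx [zy _]; exists [:: x; y; z]; last exact: Eqv_refl.
  by rewrite /dsorted /= -yx -zy.
- case=> _ _ xz yx _; exists [:: z; x; y]; first by rewrite /dsorted /= -xz -yx.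
  by apply: (@eqv_bwd false); rewrite /= -?xz -?yx.
Qed.

Lemma dsorted_eq d u v : dsorted d u -> dsorted d v -> perm_eq u v -> u = v.
Proof.
apply: sorted_eq; first exact: dlt_trans.
by move=> x y /andP[/dlt_asym->].
Qed.

Lemma same_order_eq (u v : seq nat) (s : 'S_3) : uniq u -> perm_eq u v ->
  is_order_perm u s -> is_order_perm v s -> u = v.
Proof.
move=> Uu uv us vs; have /andP[/eqP su _] := us; have /andP[/eqP sv _] := vs.
case: u Uu uv us su => [|x [|y [|z [|? ?]]]] // Uu uv us _.
case: v uv vs sv => [|x' [|y' [|z' [|? ?]]]] // uv vs _.
have [e1 e2 e3 e4 [e5 e6]] := order_permP us; have [] := order_permP vs.
rewrite {}e1 {}e2 {}e3 {}e4 {}e5 {}e6 => e1 e2 e3 e4 [e5 e6] {us vs}.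
have := perm_mem uv => M; move: Uu.
have := M x; have := M y; have := M z; rewrite !inE !eqxx ?orbT => /esym mz /esym my /esym mx.
rewrite /= !inE !negb_or andbT => /andP[/andP[/eqP xy /eqP xz] /eqP yz].
clear M uv.
by case/or3P: mx => /eqP ?; case/or3P: my => /eqP ?; case/or3P: mz => /eqP ?; subst; try lia.
Qed.

Lemma together_eqv (u v : seq nat) : uniq u -> perm_eq u v -> size u = 3 ->
  order_perms_together K_123_231__321_213 u v -> eqv u v.
Proof.
move=> Uu uv su /exists_inP[B BK /exists_inP[s sB /exists_inP[t tB /andP[us vt]]]].
have sv : size v = 3 by rewrite -(perm_size uv).
have two d : B = block d -> eqv u v.
  move=> eB; rewrite eB in sB tB.
  case: u Uu uv su us => [|x [|y [|z [|? ?]]]] // Uu uv _ us.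
  case: v uv vt sv => [|x' [|y' [|z' [|? ?]]]] // uv vt _.
  have [w cw uw] := block_dsorted us sB; have [w' cw' vw'] := block_dsorted vt tB.
  have ww' : w = w'.
    apply: dsorted_eq cw cw' _; have := eqv_perm uw; rewrite perm_sym => wu.
    exact: perm_trans wu (perm_trans uv (eqv_perm vw')).
  by apply: eqv_trans uw _; rewrite ww'; exact: eqv_sym.
move: BK; rewrite !inE => /orP[/orP[/eqP eB|/eqP eB]|/imsetP[x _ eB]].
- exact: (two true).
- exact: (two false).
- move: sB tB; rewrite eB !inE => /eqP es /eqP et; rewrite es in us; rewrite et in vt.
  by rewrite (same_order_eq Uu uv us vt); exact: Eqv_refl.
Qed.

Lemma is_order_perm3 (x y z : nat) (s : 'S_3) (a b c : nat) : oneline s = [:: a; b; c] ->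
  uniq [:: a; b; c] -> uniq [:: x; y; z] ->
  (a < b) = (x < y) -> (b < c) = (y < z) -> (a < c) = (x < z) ->
  is_order_perm [:: x; y; z] s.
Proof.
move=> os; rewrite /= !inE !negb_or => U1 U2 e1 e2 e3; apply/andP; split=> //.
apply/forallP => i; apply/forallP => j; apply/eqP.
rewrite -[s i < s j]ltnS -!nth_oneline os.
by case: i j => [[|[|[|?]]] ?] [[|[|[|?]]] ?] //=; rewrite ?ltnn //;
  move: U1 U2 e1 e2 e3; clear; lia.
Qed.

Lemma rotation_together d (x y z : nat) : dlt d x y -> dlt d y z ->
  order_perms_together K_123_231__321_213 [:: x; y; z] [:: y; z; x].
Proof.
move=> xy yz; apply/exists_inP; exists (block d).
  by rewrite !inE; case: (d); rewrite eqxx ?orbT.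
have mk w : perm_eq w (iota 1 3) -> exists s : 'S_3, oneline s = w := @oneline_surj 3 w.
case: d xy yz => /= xy yz.
  have [s es] := mk [:: 1; 2; 3] isT; have [t et] := mk [:: 2; 3; 1] isT.
  apply/exists_inP; exists s; first by rewrite !inE es.
  apply/exists_inP; exists t; first by rewrite !inE et.
  apply/andP; split;
    [apply: is_order_perm3 es _ _ _ _ _ | apply: is_order_perm3 et _ _ _ _ _] => //=;
  by move: xy yz; rewrite ?inE; clear; lia.
have [s es] := mk [:: 3; 2; 1] isT; have [t et] := mk [:: 2; 1; 3] isT.
apply/exists_inP; exists s; first by rewrite !inE es.
apply/exists_inP; exists t; first by rewrite !inE et.
apply/andP; split;
  [apply: is_order_perm3 es _ _ _ _ _ | apply: is_order_perm3 et _ _ _ _ _] => //=;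
by move: xy yz; rewrite ?inE; clear; lia.
Qed.

Lemma K_step_eqv n (phi psi : 'S_n) : K_step K_123_231__321_213 phi psi ->
  eqv (oneline phi) (oneline psi).
Proof.
case/K_stepP => a [u [v [b [e1 e2 su sv uv]]]].
have pe : perm_eq (oneline phi) (oneline psi).
  by apply: perm_trans (oneline_perm _) _; rewrite perm_sym oneline_perm.
have Uphi : uniq (oneline phi) by rewrite (perm_uniq (oneline_perm _)) iota_uniq.
rewrite e1 e2 in pe Uphi *; apply: eqv_cat; apply: together_eqv => //.
  by move: Uphi; rewrite !cat_uniq => /and3P[_ _ /andP[]].
by move: pe; rewrite perm_cat2l perm_cat2r.
Qed.

Lemma rot3_K_step n (phi psi : 'S_n) : rot3 (oneline phi) (oneline psi) ->
  K_step K_123_231__321_213 phi psi.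
Proof.
case/rot3P => a [b [d [x [y [z [xy yz [[e1 e2]|[e1 e2]]]]]]]].
  apply/K_stepP; exists a, [:: x; y; z], [:: y; z; x], b; split=> //.
  exact: rotation_together xy yz.
rewrite K_step_sym; apply/K_stepP; exists a, [:: x; y; z], [:: y; z; x], b; split=> //.
exact: rotation_together xy yz.
Qed.

Lemma K_equivP n (phi psi : 'S_n) :
  reflect (eqv (oneline phi) (oneline psi)) (K_equiv K_123_231__321_213 phi psi).
Proof.
apply: (iffP idP) => [/connectP[p pp ->]|].
  elim: p phi pp => [|s p IH] phi /=; first by move=> _; exact: Eqv_refl.
  by case/andP => /K_step_eqv e /IH; apply: eqv_trans.
move eu : (oneline phi) => u; move ev : (oneline psi) => v uv.
elim: uv phi eu ev => [w|v' u' w uv _ IH] phi eu ev.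
  by rewrite (oneline_inj (etrans eu (esym ev))); exact: connect0.
have [s es] : exists s : 'S_n, oneline s = v'.
  apply: oneline_surj; have := rot3_perm uv; rewrite perm_sym => vu.
  by apply: perm_trans vu _; rewrite -eu oneline_perm.
apply: connect_trans (IH s es ev); apply/connect1/rot3_K_step; by rewrite eu es.
Qed.

(** A partition into classes has as many parts as a list of representatives. *)
Lemma card_classes (T : finType) (R : rel T) (L : seq T) :
  equivalence_rel R -> uniq L -> (forall x, exists2 y, y \in L & R x y) ->
  {in L &, forall x y, R x y -> x = y} ->
  #|equivalence_partition R [set: T]| = size L.
Proof.
move=> eR UL cov inj.
have cls x y : R x y -> [set z in [set: T] | R x z] = [set z in [set: T] | R y z].
  by move=> xy; apply/setP => z; rewrite !inE; have [_ /(_ xy)->] := eR x y z.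
have -> : equivalence_partition R [set: T] =
    [set [set z in [set: T] | R x z] | x in [set x in L]].
  apply/setP => B; apply/imsetP/imsetP => -[x xT ->].
    by have [y yL xy] := cov x; exists y; rewrite ?inE // (cls _ _ xy).
  by exists x; rewrite ?inE.
rewrite card_in_imset; first by rewrite cardsE; apply/card_uniqP.
move=> x y; rewrite !inE => xL yL e; apply: inj => //.
have : y \in [set z in [set: T] | R y z] by rewrite !inE; have [] := eR y y y.
by rewrite -e !inE.
Qed.

Lemma card_K_classes n : 5 < n -> #|K_classes K_123_231__321_213 n| = 2 * (n + n./2).
Proof.
move=> hn; have [Ur inj] := all_reps_uniq_inj hn.
have [L eL] : exists L : seq 'S_n, map (@oneline n) L = all_reps n.
  have : forall r, r \in all_reps n -> perm_eq r (iota 1 n) := fun r => @all_reps_perm n hn r.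
  elim: (all_reps n) => [|r l IH] H; first by exists [::].
  have [|L <-] := IH; first by move=> r' rl; apply: H; rewrite in_cons rl orbT.
  by have [s <-] := oneline_surj (H r (mem_head _ _)); exists (s :: L).
rewrite -(size_all_reps hn) -eL size_map; apply: card_classes.
- exact: K_equiv_rel.
- by apply: (@map_uniq _ _ (@oneline n)); rewrite eL.
- move=> x; have [r rr xr] := all_reps_cover hn (oneline_perm x).
  rewrite -eL in rr; case/mapP: rr xr => y yL -> xy.
  by exists y => //; apply/K_equivP.
- move=> x y xL yL /K_equivP xy; apply/oneline_inj/inj => //; by rewrite -eL map_f.
Qed.

Theorem proposition3p60 (n : nat) (hn : 5 < n) :
  (odd n -> #|K_classes K_123_231__321_213 n| = 3 * n - 1) /\
  (~~ odd n -> #|K_classes K_123_231__321_213 n| = 3 * n).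
Proof. by rewrite card_K_classes //; split; lia. Qed.
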